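(* Let $d,m\ge 1$ be integers, let $P,Q,f_1,\dots,f_m\in\mathcal{D}(\mathbb{R}^d)'$ be complex valued Schwartz distributions, and let $b_1,\dots,b_m,c_1,\dots,c_m\in\mathbf{GL}_d(\mathbb{R})$ be invertible matrices such that $b_i^{-1}c_i-b_j^{-1}c_j$ is invertible whenever $i\neq j$. Assume that $$\sum_{i=1}^{m}f_i(b_ix+c_iy)= P(x)\cdot 1(y) + 1(x)\cdot Q(y),$$ where the equality is understood in the sense of $\mathcal{D}(\mathbb{R}^d\times\mathbb{R}^d)'$. Then $P$ and $Q$ are, in the distributional sense, continuous polynomials of degree at most $m$. Furthermore, if $Q=0$ in the equation, then the degree of $P$ is at most $m-1$; analogously, if $P=0$ in the equation, then the degree of $Q$ is at most $m-1$.
   Context: $\mathcal{D}(\mathbb{R}^d)'$ is the space of complex valued Schwartz distributions on $\mathbb{R}^d$. A distribution is said to be, in the distributional sense, a continuous polynomial if it equals the distribution defined by an ordinary polynomial function with complex coefficients in $d$ real variables; degree means total degree, and the zero polynomial satisfies every degree bound. For $f\in\mathcal{D}(\mathbb{R}^d)'$ and $b,c\in\mathbf{GL}_d(\mathbb{R})$, the distribution $f(bx+cy)\in\mathcal{D}(\mathbb{R}^d\times\mathbb{R}^d)'$ is determined by its values on products of test functions $\varphi_1,\varphi_2\in\mathcal{D}(\mathbb{R}^d)$: $$f(bx+cy)\{\varphi_1(x)\varphi_2(y)\}=f\left\{\frac{1}{|\det b|\,|\det c|}\,\sigma_{b^{-1}}(\varphi_1)\ast\sigma_{c^{-1}}(\varphi_2)\right\},\qquad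 \sigma_{b^{-1}}(\varphi)(x)=\varphi(b^{-1}x),$$ where $\ast$ is convolution. For $u,v\in\mathcal{D}(\mathbb{R}^d)'$, $v(x)\cdot u(y)$ denotes the tensor product in $\mathcal{D}(\mathbb{R}^d\times\mathbb{R}^d)'$: $(v(x)\cdot u(y))\{\varphi_1(x)\varphi_2(y)\}=v\{\varphi_1\}\,u\{\varphi_2\}$. Here $1$ denotes the constant function $1$ viewed as a distribution. *)

(* Defs.v *)
From HB Require Import structures.
From mathcomp Require Import all_boot all_order all_algebra.
From mathcomp Require Import all_classical all_reals all_analysis.
From mathcomp Require Import complex.
(* The notations of mpoly clash with those of the analysis library. *)
From mathcomp Require Import -(notations) mpoly.

Set Implicit Arguments.
Unset Strict Implicit.
Unset Printing Implicit Defensive.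

Import Order.TTheory GRing.Theory Num.Theory.
Import numFieldNormedType.Exports.

Local Open Scope classical_set_scope.
Local Open Scope ring_scope.

Section TestFunctions.
Variables (R : realType) (d : nat).
Implicit Types (g : 'cV[R]_d -> R) (phi : 'cV[R]_d -> R[i]).

Definition partial g (i : 'I_d) : 'cV[R]_d -> R :=
  fun x => 'D_(delta_mx i 0) g x.

Definition partials (s : seq 'I_d) g : 'cV[R]_d -> R := foldl partial g s.

Definition smooth g : Prop :=
  forall s : seq 'I_d,
    continuous (partials s g) /\
    forall (i : 'I_d) (x : 'cV[R]_d), derivable (partials s g) x (delta_mx i 0).

Definition cpartials (s : seq 'I_d) phi : 'cV[R]_d -> R[i] :=
  fun x => (partials s (fun y => complex.Re (phi y)) x
              +i* partials s (fun y => complex.Im (phi y)) x)%C.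

Definition test_function phi : Prop :=
  [/\ smooth (fun x => complex.Re (phi x)),
      smooth (fun x => complex.Im (phi x)) &
      compact (closure [set x | phi x != 0])].

End TestFunctions.

Section Distributions.
Variable R : realType.

(* Functionals are total on functions, but only their values on test functions
   are ever constrained ([schwartz_distribution]) or compared ([dist_eq]). *)
Definition functional (d : nat) := ('cV[R]_d -> R[i]) -> R[i].

(* Continuity is the classical estimate: on every compact set K,
   |u(phi)| <= C * max_(|alpha| <= N) sup |d^alpha phi| for phi supported in K;
   M ranges over the upper bounds of that maximum. *)
Record schwartz_distribution (d : nat) := SchwartzDistribution {
  dist_fun :> ('cV[R]_d -> R[i]) -> R[i] ;
  dist_linear : forall (a : R[i]) (phi psi : 'cV[R]_d -> R[i]),
    test_function phi -> test_function psi ->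
    dist_fun (fun x => a * phi x + psi x) = a * dist_fun phi + dist_fun psi ;
  dist_continuous : forall K : set 'cV[R]_d, compact K ->
    exists (C : R) (N : nat), forall (phi : 'cV[R]_d -> R[i]) (M : R),
      test_function phi -> (forall x, ~ K x -> phi x = 0) ->
      (forall (s : seq 'I_d) x, (size s <= N)%N ->
         `|cpartials s phi x| <= M%:C%C) ->
      `|dist_fun phi| <= (C * M)%:C%C }.

Definition dist_eq (d : nat) (u v : functional d) : Prop :=
  forall phi, test_function phi -> u phi = v phi.

(* Iterated Lebesgue integral; by Fubini it is the integral over R^d for the
   integrands used below, which are continuous with compact support. *)
Fixpoint integral_Rn (d : nat) : ('cV[R]_d -> R) -> R :=
  match d with
  | 0 => fun g => g 0
  | d'.+1 => fun g =>
      \int[lebesgue_measure]_(t in [set: R])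
        integral_Rn (fun x : 'cV[R]_d' => g (col_mx (t%:M : 'cV[R]_1) x))
  end.

Definition cintegral_Rn (d : nat) (phi : 'cV[R]_d -> R[i]) : R[i] :=
  (integral_Rn (fun x => complex.Re (phi x))
     +i* integral_Rn (fun x => complex.Im (phi x)))%C.

Definition regular_dist (d : nat) (h : 'cV[R]_d -> R[i]) : functional d :=
  fun phi => cintegral_Rn (fun x => h x * phi x).

Definition convolution (d : nat) (phi psi : 'cV[R]_d -> R[i]) :
    'cV[R]_d -> R[i] :=
  fun x => cintegral_Rn (fun y => phi (x - y) * psi y).

(* R^d x R^d is identified with R^(d + d): (x, y) is the column [col_mx x y]. *)
Definition tensor_fun (d : nat) (phi1 phi2 : 'cV[R]_d -> R[i]) :
    'cV[R]_(d + d) -> R[i] :=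
  fun z => phi1 (usubmx z) * phi2 (dsubmx z).

(* sigma b phi is the function written sigma_(b^-1)(phi) in
   f(bx + cy){phi1(x) phi2(y)}
     = f{ |det b|^-1 |det c|^-1 sigma_(b^-1)(phi1) * sigma_(c^-1)(phi2) }. *)
Definition sigma_inv (d : nat) (b : 'M[R]_d) (phi : 'cV[R]_d -> R[i]) :
    'cV[R]_d -> R[i] :=
  fun x => phi (invmx b *m x).

(* F is the distribution f(bx + cy); products of test functions span a dense
   subspace, so F is unique up to [dist_eq]. *)
Definition is_lin_subst (d : nat) (f : schwartz_distribution d) (b c : 'M[R]_d)
    (F : schwartz_distribution (d + d)) : Prop :=
  forall phi1 phi2, test_function phi1 -> test_function phi2 ->
    F (tensor_fun phi1 phi2) =
    f (fun z => ((`|\det b| * `|\det c|)^-1)%:C%C *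
                convolution (sigma_inv b phi1) (sigma_inv c phi2) z).

(* T is the tensor product v(x) . u(y). *)
Definition is_tensor (d : nat) (v u : functional d)
    (T : schwartz_distribution (d + d)) : Prop :=
  forall phi1 phi2, test_function phi1 -> test_function phi2 ->
    T (tensor_fun phi1 phi2) = v phi1 * u phi2.

(* The degree of p is at most k iff msize p <= k.+1; msize 0 = 0. *)
Definition is_polynomial_of_degree_le (d k : nat) (u : functional d) : Prop :=
  exists p : mpoly.mpoly d R[i],
    (mpoly.msize p <= k.+1)%N /\
    dist_eq u (regular_dist (fun x => mpoly.meval (fun i => (x i 0)%:C%C) p)).

End Distributions.

(* Main.v *)
Require Import Defs.
From HB Require Import structures.
From mathcomp Require Import all_boot all_order all_algebra.
From mathcomp Require Import all_classical all_reals all_analysis.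
From mathcomp Require Import complex ring lra.
From mathcomp Require Import -(notations) mpoly.

(** Write [t_h] for the translation of test functions by [h]. The distribution
    [f (b x + c y)] is unchanged by a translation [(h, k)] of [(x, y)] with
    [b h + c k = 0] ([lin_subst_invariant]). As the matrices are invertible, any
    vectors [h_1, ..., h_m] have companions [k_1, ..., k_m] with
    [b_i h_i + c_i k_i = 0], and conversely. The product over [i] of the operators
    [t_(h_i) (x) t_(k_i) - 1] therefore annihilates the left-hand side of the
    equation, its [i]-th factor killing the [i]-th summand. On the right-hand side
    it leaves [D_h P (x) 1 + 1 (x) D_k Q], where [D_h] and [D_k] are [m]-fold
    differences ([separated_cancellation]). Hence [D_h P] is a constant, equal to
    zero if [Q = 0], and one more difference annihilates it in all cases.

    It remains to see that a distribution [T] annihilated by all [n]-fold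
    differences is a polynomial of degree less than [n]
    ([real_distribution_frechet]; real and imaginary parts are treated separately).
    Fix a test function [chi] of integral one. The function [p y = T (t_y chi)] is
    a polynomial of degree less than [n] ([orbit_polynomial]), because its partial
    derivatives are of the same kind for the distributions [T o d_i], which are
    annihilated by [(n-1)]-fold differences. Since [T] commutes with integrals of
    test functions, the integral of [p psi] is [T (chi * psi)], that is, the mean of
    [T (t_y psi)] with weight [chi y]. When [psi] is an [(n-1)]-fold difference,
    [T (t_y psi) = T psi] for every [y], so that the mean is [T psi]. Thus
    [T - p] is annihilated by [(n-1)]-fold differences, and induction applies.

    Two exchanges carry the analysis: a distribution commutes with derivatives
    ([rdist_derive_family]) and with integrals ([rdist_integral_Rn]) with respect to
    a parameter. The first follows from the seminorm estimate, the mean value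
    theorem and compactness ([tube]); the second from the first and the
    fundamental theorem of calculus, one coordinate at a time. *)

Set Implicit Arguments.
Unset Strict Implicit.
Unset Printing Implicit Defensive.

Import Order.TTheory GRing.Theory Num.Theory.
Import numFieldNormedType.Exports.

Local Open Scope classical_set_scope.
Local Open Scope ring_scope.

(** * Continuous maps *)

Section GlobalContinuity.
Variables (R : realType) (U : topologicalType).

Lemma continuous_const (V : topologicalType) (a : V) : continuous (fun _ : U => a).
Proof. by move=> u; exact: cvg_cst. Qed.

Lemma continuous_ident : continuous (fun u : U => u).
Proof. by move=> u; exact: cvg_id. Qed.

Lemma continuous_then (V W : topologicalType) (f : U -> V) (g : V -> W) :
  continuous f -> continuous g -> continuous (fun u => g (f u)).
Proof. by move=> cf cg u; apply: (@continuous_comp _ _ _ f g); [exact: cf|exact: cg]. Qed.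

Lemma continuous_pairing (V W : topologicalType) (f : U -> V) (g : U -> W) :
  continuous f -> continuous g -> continuous (fun u => (f u, g u)).
Proof. by move=> cf cg u; apply: cvg_pair; [exact: cf|exact: cg]. Qed.

Lemma continuous_add (V : normedModType R) (f g : U -> V) :
  continuous f -> continuous g -> continuous (fun u => f u + g u).
Proof. by move=> cf cg u; apply: cvgD; [exact: cf|exact: cg]. Qed.

Lemma continuous_opp (V : normedModType R) (f : U -> V) :
  continuous f -> continuous (fun u => - f u).
Proof. by move=> cf u; apply: cvgN; exact: cf. Qed.

Lemma continuous_scale (V : normedModType R) (f : U -> R) (g : U -> V) :
  continuous f -> continuous g -> continuous (fun u => f u *: g u).
Proof. by move=> cf cg u; apply: cvgZ; [exact: cf|exact: cg]. Qed.

Lemma continuous_mul (f g : U -> R) :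
  continuous f -> continuous g -> continuous (fun u => f u * g u).
Proof. by move=> cf cg u; apply: cvgM; [exact: cf|exact: cg]. Qed.

Lemma continuous_sum (I : Type) (r : seq I) (F : I -> U -> R) :
  (forall i, continuous (F i)) -> continuous (fun u => \sum_(i <- r) F i u).
Proof.
move=> cF; elim: r => [|i r IH] u.
  by under eq_fun do rewrite big_nil; exact: cvg_cst.
by under eq_fun do rewrite big_cons; apply: cvgD; [exact: cF|exact: IH].
Qed.

Lemma continuous_proj1 (V : topologicalType) : continuous (fun p : U * V => p.1).
Proof. by move=> p; exact: cvg_fst. Qed.

Lemma continuous_proj2 (V : topologicalType) : continuous (fun p : V * U => p.2).
Proof. by move=> p; exact: cvg_snd. Qed.

End GlobalContinuity.

(** Compactness of [K] makes joint continuity uniform: near each point of [K] the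
    estimate holds for all parameters close to [u0], and finitely many such
    neighbourhoods cover [K]. *)
Lemma tube (R : realType) (U V : topologicalType) (K : set V) (G : U * V -> R)
    (u0 : U) (e : R) : compact K -> continuous G -> 0 < e ->
  \forall u \near u0, forall v, K v -> `|G (u, v) - G (u0, v)| < e.
Proof.
move=> /compact_near_coveringP cK cG e0.
apply: (cK U (nbhs u0) (fun u v => `|G (u, v) - G (u0, v)| < e)) => v Kv.
have e20 : 0 < e / 2 by rewrite divr_gt0.
have /cvgrPdist_lt/(_ _ e20) [/= [A B] /= [A0 B0] AB] := cG (u0, v).
exists (B, A) => // -[v' u'] /= [Bv' Au'].
have h1 := AB (u', v') (conj Au' Bv').
have h2 := AB (u0, v') (conj (nbhs_singleton A0) Bv').
rewrite /= in h1 h2.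
rewrite (_ : G _ - _ = (G (u0, v) - G (u0, v')) - (G (u0, v) - G (u', v'))); last by ring.
by rewrite (le_lt_trans (ler_normB _ _))// [e]splitr ltrD.
Qed.

(** * Calculus in one real variable *)

Section RealIntegrals.
Variable R : realType.
Notation mu := (@lebesgue_measure R).

Lemma continuous_integrable_itv (f : R -> R) a b : continuous f ->
  mu.-integrable `[a, b] (EFin \o f).
Proof.
move=> cf; apply: (@continuous_compact_integrable R f `[a, b]).
  exact: segment_compact.
exact: continuous_subspaceT.
Qed.

Lemma le_Rintegral_itv (f : R -> R) (a b M : R) : continuous f -> a <= b ->
  (forall t, a <= t <= b -> `|f t| <= M) ->
  `|\int[mu]_(t in `[a, b]) f t| <= (b - a) * M.
Proof.
move=> cf ab fM.
have mI : measurable (`[a, b] : set (measurableTypeR R)) by [].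
apply: (le_trans (le_normr_Rintegral mI (continuous_integrable_itv a b cf))).
have -> : (b - a) * M = \int[mu]_(t in `[a, b]) M.
  rewrite (Rintegral_cst mu mI) [X in fine X]lebesgue_measure_itv/= lte_fin mulrC.
  by case: ltP => //= ba; rewrite (_ : b = a) ?subrr//; apply/eqP; rewrite eq_le ba ab.
apply: le_Rintegral => //.
- apply: continuous_integrable_itv => x.
  by apply: continuous_comp; [exact: cf|exact: norm_continuous].
- by apply: continuous_integrable_itv => x; exact: cvg_cst.
Qed.

Lemma continuous_slice (U V W : topologicalType) (G : U * V -> W) u :
  continuous G -> continuous (fun v => G (u, v)).
Proof.
move=> cG; apply: (@continuous_then _ _ _ (fun v => (u, v)) G) => //.
by apply: continuous_pairing; [exact: continuous_const|exact: continuous_ident].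
Qed.

Lemma continuous_Rintegral_itv (U : topologicalType) (G : U * R -> R) a b :
  continuous G -> continuous (fun u => \int[mu]_(t in `[a, b]) G (u, t)).
Proof.
move=> cG u0; have [ba|ab] := ltP b a.
  rewrite (_ : (fun u => _) = cst 0); first exact: cvg_cst.
  by apply/funext => u; rewrite set_itv_ge ?Rintegral_set0// bnd_simp -ltNge.
apply/cvgrPdist_lt => e e0.
have e'0 : 0 < e / (b - a + 1).
  by rewrite divr_gt0// ltr_wpDl// subr_ge0.
apply: filterS (tube u0 (@segment_compact _ a b) cG e'0) => u hu.
have ci v := continuous_integrable_itv a b (@continuous_slice _ _ _ G v cG).
rewrite -RintegralB//.
apply: (@le_lt_trans _ _ ((b - a) * (e / (b - a + 1)))).
  apply: le_Rintegral_itv => //.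
    by move=> t; apply: cvgB; exact: continuous_slice.
  by move=> t tab; rewrite distrC ltW// hu//= in_itv.
rewrite mulrCA -[ltRHS]mulr1 ltr_pM2l// ltr_pdivrMr ?mul1r; last first.
  by rewrite ltr_wpDl// subr_ge0.
by rewrite ltrDl.
Qed.

End RealIntegrals.

Section OneVariable.
Variable R : realType.
Notation mu := (@lebesgue_measure R).
Implicit Types f df : R -> R.

(** The difference quotient with its denominator cleared: in this form the
    hypothesis can come directly from a bound on an integral or on the value of
    a distribution. *)
Lemma is_derive_estimate f (s l : R) :
  (forall e, 0 < e -> \forall u \near s, `|f u - f s - (u - s) * l| <= e * `|u - s|) ->
  is_derive s 1 f l.
Proof.
move=> H.
have H' : h^-1 *: ((f \o shift s) (h *: 1) - f s) @[h --> 0^'] --> l.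
  apply/cvgrPdist_le => e e0.
  have /nbhs_ballP[d /= d0 Hd] := H e e0.
  exists d => //= h; rewrite /ball/= sub0r normrN => hd h0.
  have := Hd (h + s); rewrite /ball /= addrK opprD addrCA subrr addr0 normrN => /(_ hd).
  move=> K; rewrite /GRing.scale /= mulr1.
  have nh0 : 0 < `|h| by rewrite normr_gt0.
  rewrite -(ler_pM2r nh0); apply: le_trans K; rewrite -normrM distrC.
  rewrite mulrBl mulrAC mulVf// mul1r [l * h]mulrC; exact: lexx.
have -> : l = 'D_1 f s by apply/esym/cvg_lim.
by apply: derivableP; apply/cvg_ex; exists l.
Qed.

Lemma is_derive_continuous f (s l : R) : is_derive s 1 f l -> {for s, continuous f}.
Proof.
by move=> [h _]; apply: differentiable_continuous; apply/derivable1_diffP.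
Qed.

(** Stated without ordering the end points, so that increments of both signs are
    treated at once. *)
Lemma mean_value f df (a b : R) : (forall x : R, is_derive x 1 f (df x)) ->
  exists c, `|c - a| <= `|b - a| /\ f b - f a = df c * (b - a).
Proof.
move=> fd.
have cf (A : set R) : {within A, continuous f}.
  by apply: continuous_subspaceT => x; exact: is_derive_continuous (fd x).
have [ab|ba] := leP a b.
  have [c] := MVT_segment ab (fun x _ => fd x) (cf _).
  rewrite in_itv/= => /andP[ac cb] E; exists c; split => //.
  by rewrite !ger0_norm ?subr_ge0// lerB.
have [c] := MVT_segment (ltW ba) (fun x _ => fd x) (cf _).
rewrite in_itv/= => /andP[ac cb] E; exists c; split.
  by rewrite !ler0_norm ?subr_le0// ?(ltW ba)// lerN2 lerB.
by rewrite -[f b - f a]opprB E; ring.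
Qed.

Lemma derive0_constant f (a b : R) : a <= b ->
  (forall x : R, a <= x <= b -> is_derive x 1 f 0) -> f a = f b.
Proof.
move=> ab fd; apply/eqP; rewrite eq_sym -subr_eq0; apply/eqP.
have [||c _ ->] := @MVT_segment _ f (fun=> 0) a b ab; last by rewrite mul0r.
- by move=> x; rewrite in_itv/= => /andP[/ltW ax /ltW xb]; apply: fd; rewrite ax.
- apply/continuous_in_subspaceT => x; rewrite inE/= in_itv/= => /fd.
  exact: is_derive_continuous.
Qed.

(** By the mean value theorem the first-order error of the integrand is
    [u - s] times the variation of [dG (_, t)] between [s] and a point at least
    as close to [s] as [u]; that variation is small uniformly in [t] because
    [`[a, b]] is compact. *)
Lemma derive_Rintegral_itv (G dG : R * R -> R) (a b s : R) :
  (forall s t : R, is_derive s 1 (fun s => G (s, t)) (dG (s, t))) ->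
  continuous G -> continuous dG ->
  is_derive s 1 (fun s => \int[mu]_(t in `[a, b]) G (s, t))
                (\int[mu]_(t in `[a, b]) dG (s, t)).
Proof.
move=> GdG cG cdG; have [ba|ab] := ltP b a.
  rewrite set_itv_ge ?bnd_simp -?ltNge//; under eq_fun do rewrite Rintegral_set0.
  by rewrite Rintegral_set0; exact: is_derive_cst.
apply: is_derive_estimate => e e0.
have ba0 : 0 < b - a + 1 by rewrite ltr_wpDl// subr_ge0.
have e'0 : 0 < e / (b - a + 1) by rewrite divr_gt0.
have /nbhs_ballP[d /= d0 Hd] := tube s (@segment_compact _ a b) cdG e'0.
apply/nbhs_ballP; exists d => //= u su.
have ci v := continuous_integrable_itv a b (@continuous_slice _ _ _ G v cG).
have ci' v := continuous_integrable_itv a b (@continuous_slice _ _ _ dG v cdG).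
have cB : continuous (fun t => G (u, t) - G (s, t)).
  by move=> t; apply: cvgB; exact: continuous_slice.
have cM : continuous (fun t => (u - s) * dG (s, t)).
  by move=> t; apply: cvgM; [exact: cvg_cst|exact: continuous_slice].
rewrite -RintegralB// -RintegralZl// -RintegralB//; last 2 first.
- exact: continuous_integrable_itv.
- exact: continuous_integrable_itv.
apply: (@le_trans _ _ ((b - a) * (e / (b - a + 1) * `|u - s|))).
  apply: le_Rintegral_itv => //.
    by move=> t; apply: cvgB; [exact: cB|exact: cM].
  move=> t tab; have [c [cs ->]] := mean_value s u (fun s => GdG s t).
  rewrite [_ * (u - s)]mulrC -mulrBr normrM mulrC ler_wpM2r//.
  have : ball s d c.
    by rewrite /ball/= distrC (le_lt_trans cs)// distrC.
  by move/Hd => /(_ t); rewrite /= in_itv/= => /(_ tab)/ltW.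
rewrite mulrA ler_wpM2r// mulrCA -[leRHS]mulr1 ler_wpM2l ?ltW// ltr_pdivrMr ?mul1r//.
by rewrite ltrDl.
Qed.

Lemma derive_upper_limit f (a x : R) : continuous f -> a < x ->
  is_derive x 1 (fun x => \int[mu]_(t in `[a, x]) f t) (f x).
Proof.
move=> cf ax.
have [||h1 h2] := @continuous_FTC1_closed _ f a x (x + 1) _ (continuous_integrable_itv _ _ cf) ax.
- by rewrite ltrDl.
- exact: cf.
by apply: (DeriveDef h1); rewrite -derive1E.
Qed.

End OneVariable.

Section LineIntegral.
Variable R : realType.
Notation mu := (@lebesgue_measure R).
Implicit Types f F : R -> R.

(** A radius for the support: the only trace of compact supports that the
    estimates use, and one that passes well to slices and translates. *)
Definition vanishes_beyond (V : normedModType R) (A : R) (g : V -> R) : Prop :=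
  forall x, A < `|x| -> g x = 0.

Lemma Rintegral_line f a b : (forall t, ~~ (a <= t <= b) -> f t = 0) ->
  \int[mu]_(t in [set: R]) f t = \int[mu]_(t in `[a, b]) f t.
Proof.
move=> f0; rewrite [RHS]Rintegral_mkcond; congr (Rintegral _ _ _).
apply/funext => t; rewrite patchE; case: ifPn => //.
by rewrite notin_setE/= in_itv/= => /negP; exact: f0.
Qed.

Lemma Rintegral_line_norm f A : vanishes_beyond A f ->
  \int[mu]_(t in [set: R]) f t = \int[mu]_(t in `[- A, A]) f t.
Proof.
move=> f0; apply: Rintegral_line => t; rewrite -ler_norml -ltNge; exact: f0.
Qed.

Lemma Rintegral_FTC f F a b : a <= b -> continuous f ->
  (forall x : R, a <= x <= b -> is_derive x 1 F (f x)) ->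
  \int[mu]_(t in `[a, b]) f t = F b - F a.
Proof.
rewrite le_eqVlt => /predU1P[->|ab] cf Ff.
  by rewrite set_itv1 Rintegral_set1 subrr.
have cF (x : R) : a <= x <= b -> {for x, continuous F}.
  by move=> /Ff; exact: is_derive_continuous.
rewrite /Rintegral (@continuous_FTC2 _ f F a b ab)//.
- exact: continuous_subspaceT.
- split.
  + by move=> x; rewrite in_itv/= => /andP[/ltW ax /ltW xb];
      have [] := Ff x; rewrite ?ax.
  + by apply: cvg_at_right_filter; apply: cF; rewrite lexx ltW.
  + by apply: cvg_at_left_filter; apply: cF; rewrite lexx ltW.
- move=> x; rewrite in_itv/= => /andP[/ltW ax /ltW xb].
  by rewrite derive1E; apply: derive_val; apply: Ff; rewrite ax.
Qed.

(** The condition [s * s = 1] covers translation and reflection together. If [F]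
    is an antiderivative of [f], then [s * F (v + s * t)] is one of the integrand
    on the left, precisely because [s * s = 1]. *)
Lemma Rintegral_line_affine f A v s : s * s = 1 -> continuous f ->
  vanishes_beyond A f ->
  \int[mu]_(t in [set: R]) f (v + s * t) = \int[mu]_(t in [set: R]) f t.
Proof.
move=> ss cf f0.
(* The left integrand vanishes outside [- B, B], the right one outside the image
   [v - B, v + B] of this interval, whatever the sign of s. *)
pose B := `|A| + `|v|.
have s1 : `|s| = 1.
  by apply/eqP; rewrite -(eqrXn2 (n := 2))// expr1n -normrX expr2 ss normr1.
have B0 : 0 <= B by rewrite addr_ge0.
have AB : A <= `|A| by exact: ler_norm.
have /andP[vB Bv] : - `|v| <= v <= `|v| by rewrite -ler_norml.
rewrite (@Rintegral_line f (v - B) (v + B)); last first.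
  move=> t H; apply: f0; rewrite ltNge; apply: contra H; rewrite ler_norml => /andP[H1 H2].
  by rewrite /B; apply/andP; split; lra.
rewrite (@Rintegral_line (fun t => f (v + s * t)) (- B) B); last first.
  move=> t H; apply: f0; rewrite ltNge; apply: contra H => H.
  rewrite -ler_norml -[`|t|]mul1r -s1 -normrM.
  rewrite (_ : s * t = (v + s * t) - v); last by ring.
  by rewrite (le_trans (ler_normB _ _))// lerD// (le_trans H).
have cg : continuous (fun t => f (v + s * t)).
  move=> t; apply: (@continuous_comp _ _ _ (fun t => v + s * t) f); last exact: cf.
  by apply: cvgD; [exact: cvg_cst|apply: cvgM; [exact: cvg_cst|exact: cvg_id]].
pose a := v - B - 1.
pose F x := \int[mu]_(t in `[a, x]) f t.
have dF (x : R) : v - B <= x -> is_derive x 1 F (f x).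
  by move=> vBx; apply: derive_upper_limit => //; rewrite /a; lra.
have -> : \int[mu]_(t in `[v - B, v + B]) f t = F (v + B) - F (v - B).
  apply: Rintegral_FTC => //; first lra.
  by move=> x /andP[? _]; exact: dF.
pose G t := s * F (v + s * t).
have -> : \int[mu]_(t in `[- B, B]) f (v + s * t) = G B - G (- B).
  apply: Rintegral_FTC => //; first lra.
  move=> x xB.
  have h : is_derive (v + s * x) 1 F (f (v + s * x)).
    apply: dF; rewrite lerD2l lerNl.
    by move: xB; rewrite -ler_norml => xB; rewrite (le_trans _ xB)//
      -[leRHS]mul1r -s1 -normrM -normrN ler_norm.
  have h2 : is_derive x 1 (fun t => v + s * t) s.
    have h3 : is_derive x 1 (s \*: id) (s *: 1) by exact: is_deriveZ.
    have h4 : is_derive x 1 (cst v + s \*: id) (0 + s *: 1).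
      exact: (is_deriveD (is_derive_cst v x 1) h3).
    by move: h4; rewrite /GRing.scale/= mulr1 add0r.
  have h5 := is_deriveZ s (@is_derive1_comp _ F (fun t => v + s * t) x _ _ h h2).
  by move: h5; rewrite /GRing.scale/= mulrCA ss mulr1.
rewrite /G.
have : (s - 1) * (s + 1) = 0 by rewrite -subr_sqr expr1n expr2 ss subrr.
move=> /eqP; rewrite mulf_eq0 subr_eq0 addr_eq0 => /orP[] /eqP ->.
- by rewrite !mul1r.
- by rewrite !mulN1r !opprK addrC.
Qed.
End LineIntegral.

(** * Spaces of columns *)

Section Columns.
Variable R : realType.

Lemma mx_norm_leP m n (x : 'M[R]_(m, n)) (e : R) : 0 <= e ->
  (`|x| <= e) <-> (forall i j, `|x i j| <= e).
Proof.
move=> e0; have -> : `|x| = \big[Num.max/0]_ij `|x ij.1 ij.2| by rewrite -mx_normrE.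
split.
  move=> /bigmax_leP[_ H] i j; exact: (H (i, j)).
by move=> H; apply/bigmax_leP; split => // -[i j] _; exact: H.
Qed.

Lemma mx_norm_ltP m n (x : 'M[R]_(m, n)) (e : R) : 0 < e ->
  (`|x| < e) <-> (forall i j, `|x i j| < e).
Proof.
move=> e0; have -> : `|x| = \big[Num.max/0]_ij `|x ij.1 ij.2| by rewrite -mx_normrE.
split.
  move=> /bigmax_ltP[_ H] i j; exact: (H (i, j)).
by move=> H; apply/bigmax_ltP; split => // -[i j] _; exact: H.
Qed.

Lemma continuous_matrix (U : topologicalType) m n (f : U -> 'M[R]_(m, n)) :
  (forall i j, continuous (fun u => f u i j)) -> continuous f.
Proof.
move=> cf u; apply/cvgrPdist_lt => e e0.
have H i j : \forall v \near u, `|f u i j - f v i j| < e.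
  by have /cvgrPdist_lt/(_ _ e0) := cf i j u.
have H2 : \forall v \near u, forall i j, `|f u i j - f v i j| < e.
  by apply: filter_forall => i; apply: filter_forall => j; exact: H.
by apply: filterS H2 => v K; apply/mx_norm_ltP => // i j; rewrite !mxE.
Qed.

Lemma continuous_entry (U : topologicalType) m n (f : U -> 'M[R]_(m, n)) i j :
  continuous f -> continuous (fun u => f u i j).
Proof.
move=> cf u; apply: (@continuous_comp _ _ _ f (fun M : 'M[R]_(m, n) => M i j)) => //.
  exact: cf.
exact: coord_continuous.
Qed.

Lemma continuous_col_mx (U : topologicalType) m n (f : U -> 'cV[R]_m) (g : U -> 'cV[R]_n) :
  continuous f -> continuous g -> continuous (fun u => col_mx (f u) (g u)).
Proof.
move=> cf cg; apply: continuous_matrix => i j.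
rewrite -(splitK i); case: (fintype.split i) => k /=.
  by under eq_fun do rewrite col_mxEu; exact: continuous_entry.
by under eq_fun do rewrite col_mxEd; exact: continuous_entry.
Qed.

Lemma continuous_usubmx m n : continuous (@usubmx R m n 1).
Proof.
apply: continuous_matrix => i j.
by under eq_fun do rewrite mxE; exact: coord_continuous.
Qed.

Lemma continuous_dsubmx m n : continuous (@dsubmx R m n 1).
Proof.
apply: continuous_matrix => i j.
by under eq_fun do rewrite mxE; exact: coord_continuous.
Qed.

Lemma continuous_mulmx m n (A : 'M[R]_(m, n)) : continuous (fun x : 'cV[R]_n => A *m x).
Proof.
apply: continuous_matrix => i j; under eq_fun do rewrite mxE.
apply: (@continuous_sum _ _ _ _ (fun k x => A i k * (x : 'cV[R]_n) k j)) => k.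
 apply: continuous_mul; [exact: continuous_const|exact: coord_continuous].
Qed.

(** Prepends the coordinate over which [integral_Rn] integrates last. *)
Definition cons_col d (t : R) (x : 'cV[R]_d) : 'cV[R]_d.+1 := col_mx (t%:M : 'cV[R]_1) x.

Lemma continuous_cons_col (U : topologicalType) d (f : U -> R) (g : U -> 'cV[R]_d) :
  continuous f -> continuous g -> continuous (fun u => cons_col (f u) (g u)).
Proof.
move=> cf cg; apply: (@continuous_col_mx U 1 d (fun u => (f u)%:M) g) => //.
apply: continuous_matrix => i j.
by under eq_fun do rewrite mxE !ord1 eqxx mulr1n.
Qed.

Lemma norm_cons_col d t (x : 'cV[R]_d) : `|t| <= `|cons_col t x| /\ `|x| <= `|cons_col t x|.
Proof.
have /mx_norm_leP H := lexx `|cons_col t x|.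
have {}H := H (normr_ge0 _); split.
  have := H (@lshift 1 d 0) 0.
  by rewrite /cons_col (@col_mxEu _ 1 d) mxE eqxx mulr1n.
apply/mx_norm_leP => // i j.
have := H (@rshift 1 d i) j.
by rewrite /cons_col (@col_mxEd _ 1 d).
Qed.

Lemma cons_colP d (x : 'cV[R]_d.+1) : exists t y, x = cons_col t y.
Proof.
exists (@usubmx R 1 d 1 x 0 0), (@dsubmx R 1 d 1 x); rewrite /cons_col.
by rewrite -mx11_scalar (@vsubmxK R 1 d).
Qed.

Lemma cons_col_affine d t (x : 'cV[R]_d) t' (x' : 'cV[R]_d) s :
  cons_col t x + s *: cons_col t' x' = cons_col (t + s * t') (x + s *: x').
Proof.
by rewrite /cons_col (@scale_col_mx R 1 d) (@add_col_mx R 1 d) scale_scalar_mx -raddfD.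
Qed.

Lemma compact_ball_cV d (A : R) : compact [set x : 'cV[R]_d | `|x| <= A].
Proof.
have [A0|A0] := leP 0 A; last first.
  rewrite (_ : [set _ | _] = set0); first exact: compact0.
  apply/seteqP; split=> x //= xA.
  by have := le_lt_trans (le_trans (normr_ge0 _) xA) A0; rewrite ltxx.
have ct : continuous (fun v : 'rV[R]_d => v^T : 'cV[R]_d).
  apply: continuous_matrix => i j; under eq_fun do rewrite mxE.
  exact: coord_continuous.
have cK := @rV_compact R d (fun=> `[- A, A]%classic) (fun=> @segment_compact _ _ _).
have := continuous_compact (continuous_subspaceT ct) cK; congr compact.
apply/seteqP; split=> [_ [v /= Hv <-]|x /mx_norm_leP xA] /=.
  apply/mx_norm_leP => // i j; rewrite mxE !ord1 ler_norml.
  by have := Hv i; rewrite in_itv.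
exists x^T; last by rewrite trmxK.
by move=> i; rewrite /= in_itv/= mxE -ler_norml; exact: xA.
Qed.

End Columns.

(** * The iterated integral *)

Section IteratedIntegral.
Variable R : realType.
Notation mu := (@lebesgue_measure R).

Lemma integral_RnS d (g : 'cV[R]_d.+1 -> R) :
  integral_Rn g = \int[mu]_(t in [set: R]) integral_Rn (fun x => g (cons_col t x)).
Proof. by []. Qed.

Lemma integral_Rn0 d : integral_Rn (fun _ : 'cV[R]_d => 0) = 0.
Proof.
elim: d => [//|d IH]; rewrite integral_RnS.
under eq_Rintegral do rewrite IH.
by rewrite /Rintegral integral0.
Qed.

Definition cont_supp (V : normedModType R) (A : R) (g : V -> R) :=
  continuous g /\ vanishes_beyond A g.

Lemma vanishes_integral_Rn d (A : R) (g : 'cV[R]_d.+1 -> R) : vanishes_beyond A g ->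
  vanishes_beyond A (fun t => integral_Rn (fun x => g (cons_col t x))).
Proof.
move=> g0 t At; rewrite -[RHS](@integral_Rn0 d); congr integral_Rn.
apply/funext => x; apply: g0; apply: (lt_le_trans At).
by have [] := norm_cons_col t x.
Qed.

Lemma vanishes_cons_col d (A : R) (g : 'cV[R]_d.+1 -> R) t : vanishes_beyond A g ->
  vanishes_beyond A (fun x => g (cons_col t x)).
Proof.
move=> g0 x Ax; apply: g0; apply: (lt_le_trans Ax).
by have [] := norm_cons_col t x.
Qed.

(** The parameter space [U] is arbitrary so that the induction on the dimension
    can move the first coordinate into it. *)
Lemma continuous_integral_Rn d (U : topologicalType) (G : U * 'cV[R]_d -> R) (A : R) :
  continuous G -> (forall u, vanishes_beyond A (fun x => G (u, x))) ->
  continuous (fun u => integral_Rn (fun x => G (u, x))).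
Proof.
elim: d U G => [|d IH] U G cG G0.
  change (continuous (fun u => G (u, 0))).
  have := @continuous_then U (U * 'cV[R]_0)%type R (fun u => (u, 0)) G; apply; last exact: cG.
  by apply: continuous_pairing; [exact: continuous_ident|exact: continuous_const].
under eq_fun => u do rewrite integral_RnS (Rintegral_line_norm (vanishes_integral_Rn (G0 u))).
apply: (@continuous_Rintegral_itv _ _
  (fun ut : U * R => integral_Rn (fun x => G (ut.1, cons_col ut.2 x)))).
apply: (IH _ (fun utx : (U * R) * 'cV[R]_d => G (utx.1.1, cons_col utx.1.2 utx.2))).
  apply: (@continuous_then _ _ _
    (fun utx : (U * R) * 'cV[R]_d => (utx.1.1, cons_col utx.1.2 utx.2)) G); last exact: cG.
  apply: continuous_pairing.
    by apply: (@continuous_then _ _ _ fst fst); exact: continuous_proj1.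
  apply: (@continuous_cons_col _ _ _ (fun p : (U * R) * 'cV[R]_d => p.1.2) snd);
    last exact: continuous_proj2.
  apply: (@continuous_then _ _ _ fst snd); [exact: continuous_proj1|exact: continuous_proj2].
by move=> [u t]; exact: (vanishes_cons_col (g := fun x => G (u, x))).
Qed.

Lemma cont_supp_cons_col d A (g : 'cV[R]_d.+1 -> R) t : cont_supp A g ->
  cont_supp A (fun x => g (cons_col t x)).
Proof.
move=> [cg g0]; split; last exact: vanishes_cons_col.
apply: (@continuous_then _ _ _ (cons_col t) g); last exact: cg.
by apply: (@continuous_cons_col _ _ _ (fun=> t) id);
  [exact: continuous_const|exact: continuous_ident].
Qed.

Lemma cont_supp_inner d A (g : 'cV[R]_d.+1 -> R) : cont_supp A g ->
  cont_supp A (fun t => integral_Rn (fun x => g (cons_col t x))).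
Proof.
move=> [cg g0]; split; last exact: vanishes_integral_Rn.
apply: (@continuous_integral_Rn d _ (fun tx : R * 'cV[R]_d => g (cons_col tx.1 tx.2)) A).
  apply: (@continuous_then _ _ _ (fun tx : R * 'cV[R]_d => cons_col tx.1 tx.2) g); last exact: cg.
  by apply: (@continuous_cons_col _ _ _ fst snd); [exact: continuous_proj1|exact: continuous_proj2].
by move=> t; exact: (vanishes_cons_col (g := g)).
Qed.

Lemma integral_Rn_linear d A (a : R) (g h : 'cV[R]_d -> R) :
  cont_supp A g -> cont_supp A h ->
  integral_Rn (fun x => a * g x + h x) = a * integral_Rn g + integral_Rn h.
Proof.
elim: d g h => [//|d IH] g h hg hh; rewrite !integral_RnS.
transitivity (\int[mu]_(t in [set: R]) (a * integral_Rn (fun x => g (cons_col t x)) +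
  integral_Rn (fun x => h (cons_col t x)))).
  congr (Rintegral _ _ _); apply/funext => t.
  exact: (IH (fun x => g (cons_col t x)) (fun x => h (cons_col t x))
          (cont_supp_cons_col t hg) (cont_supp_cons_col t hh)).
have [cg g0] := cont_supp_inner hg; have [ch h0] := cont_supp_inner hh.
rewrite (Rintegral_line_norm g0) (Rintegral_line_norm h0) (@Rintegral_line_norm _ _ A).
  rewrite RintegralD//.
  - by rewrite RintegralZl//; exact: continuous_integrable_itv.
  - by apply: continuous_integrable_itv => t; apply: cvgM; [exact: cvg_cst|exact: cg].
  - exact: continuous_integrable_itv.
by move=> t At; rewrite g0// h0// mulr0 addr0.
Qed.

Lemma le_integral_Rn d A (M : R) (g : 'cV[R]_d -> R) : 0 <= A -> cont_supp A g ->
  (forall x, `|g x| <= M) -> `|integral_Rn g| <= (A + A) ^+ d * M.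
Proof.
move=> A0; elim: d g => [|d IH] g hg gM; first by rewrite expr0 mul1r; exact: gM.
rewrite integral_RnS; have [cg g0] := cont_supp_inner hg.
rewrite (Rintegral_line_norm g0) exprS -mulrA -{1}[A in A + A]opprK [- - A + _]addrC.
apply: le_Rintegral_itv => [||t _]; [exact: cg|lra|].
by apply: (IH (fun x => g (cons_col t x))) => [|x]; [exact: cont_supp_cons_col|exact: gM].
Qed.

Lemma integral_Rn_affine d A (g : 'cV[R]_d -> R) (v : 'cV[R]_d) s : s * s = 1 ->
  cont_supp A g -> integral_Rn (fun x => g (v + s *: x)) = integral_Rn g.
Proof.
move=> ss; elim: d g v => [|d IH] g v hg.
  by rewrite /=; congr g; apply/matrixP => -[].
have [t0 [y ->]] := cons_colP v; rewrite !integral_RnS.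
have [cg g0] := cont_supp_inner hg.
rewrite -(Rintegral_line_affine t0 ss cg g0); apply: eq_Rintegral => t _.
under eq_fun do rewrite cons_col_affine.
by rewrite (IH (fun x => g (cons_col (t0 + s * t) x)))//; exact: cont_supp_cons_col.
Qed.

Lemma integral_Rn_ge0 d (g : 'cV[R]_d -> R) : (forall x, 0 <= g x) -> 0 <= integral_Rn g.
Proof.
elim: d g => [|d IH] g g0; first exact: g0.
by rewrite integral_RnS; apply: Rintegral_ge0 => t _; apply: IH.
Qed.

(** The indefinite integral of a nonnegative function is nondecreasing. If its
    total increase were zero it would be constant, whereas its derivative at
    [t0] is [f t0]. *)
Lemma Rintegral_line_gt0 A (f : R -> R) t0 : cont_supp A f -> (forall t, 0 <= f t) ->
  0 < f t0 -> 0 < \int[mu]_(t in [set: R]) f t.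
Proof.
move=> [cf f0] fge0 ft0; rewrite lt_neqAle; apply/andP; split; last by apply: Rintegral_ge0.
apply/eqP => /esym E.
have tA : `|t0| <= A.
  by rewrite leNgt; apply/negP => /f0 H; rewrite H ltxx in ft0.
have := tA; rewrite ler_norml => /andP[At0 t0A].
pose F x := \int[mu]_(t in `[- A - 1, x]) f t.
have dF (x : R) : - A - 1 < x -> is_derive x 1 F (f x).
  by move=> Ax; apply: derive_upper_limit.
have FC (x y : R) : - A <= x -> x <= y -> F x <= F y.
  move=> Ax xy; rewrite -subr_ge0.
  have -> : F y - F x = \int[mu]_(t in `[x, y]) f t.
    apply/esym; apply: Rintegral_FTC => // z /andP[xz _]; apply: dF; lra.
  by apply: Rintegral_ge0.
have F0 : F (A + 1) = F (- A).
  apply/eqP; rewrite -subr_eq0; apply/eqP.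
  have -> : F (A + 1) - F (- A) = \int[mu]_(t in `[- A, A + 1]) f t.
    apply/esym; apply: Rintegral_FTC => //; first by lra.
    by move=> z /andP[xz _]; apply: dF; lra.
  rewrite -E; apply/esym; apply: Rintegral_line => t /negP H; apply: f0.
  by rewrite ltNge ler_norml; apply/negP => /andP[H1 H2]; apply: H; apply/andP; split; lra.
have Fc (x : R) : - A <= x -> x <= A + 1 -> F x = F (- A).
  move=> H1 H2; have := FC _ _ (lexx _) H1; have := FC _ _ H1 H2; rewrite F0 => K1 K2.
  by apply/eqP; rewrite eq_le K1 K2.
have [e [e0 He]] : exists e : R, 0 < e /\ forall t, `|t - t0| < e -> 0 < f t.
  have /cvgrPdist_lt/(_ _ ft0)/nbhs_ballP[e /= e0 He] := cf t0.
  exists e; split => // t; rewrite distrC => /He /=; rewrite ltr_norml => /andP[_]; lra.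
pose u := t0 + Num.min 1 (e / 2).
have [u1 u2 u3] : [/\ t0 < u, u <= t0 + 1 & u < t0 + e].
  rewrite /u; have e20 : 0 < e / 2 by rewrite divr_gt0.
  split; rewrite ?ltrDl ?lt_min ?ltr01 ?e20// ?lerD2l ?ge_min ?lexx//.
  rewrite ltrD2l; apply: le_lt_trans (_ : e / 2 < e); rewrite ?ge_min ?lexx ?orbT//; lra.
have := Fc t0 At0; have := Fc u.
have [c ct E2] : exists2 c, c \in `]t0, u[ & F u - F t0 = f c * (u - t0).
  have [||c] := @MVT _ F f t0 u u1.
  - by move=> x; rewrite in_itv/= => /andP[H1 H2]; apply: dF; lra.
  - apply/continuous_in_subspaceT => x; rewrite inE/= in_itv/= => /andP[H1 H2].
    by apply: is_derive_continuous (dF x _); lra.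
  - by exists c.
move: ct; rewrite in_itv/= => /andP[c1 c2] H1 H2.
have fc : 0 < f c by apply: He; rewrite ltr_norml; apply/andP; split; lra.
have : 0 < F u - F t0 by rewrite E2 mulr_gt0// subr_gt0.
by rewrite H1 ?H2 ?subrr ?ltxx//; lra.
Qed.

Lemma integral_Rn_gt0 d A (g : 'cV[R]_d -> R) x : cont_supp A g ->
  (forall x, 0 <= g x) -> 0 < g x -> 0 < integral_Rn g.
Proof.
elim: d g x => [|d IH] g x hg g0 gx.
  by rewrite /= (_ : 0 = x)//; apply/matrixP => -[].
rewrite integral_RnS; have [t [y E]] := cons_colP x.
apply: (@Rintegral_line_gt0 A _ t); first exact: cont_supp_inner.
  by move=> s; exact: integral_Rn_ge0.
by apply: (IH _ y) => //; [exact: cont_supp_cons_col|rewrite -E].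
Qed.

End IteratedIntegral.

(** * Directional derivatives *)

Section Directional.
Variables (R : realType) (V : normedModType R).
Implicit Types (f : V -> R) (x v : V).

Lemma is_derive_estimateP (g : R -> R) (s l : R) : is_derive s 1 g l ->
  forall e, 0 < e -> \forall u \near s, `|g u - g s - (u - s) * l| <= e * `|u - s|.
Proof.
move=> [dg gl] e e0.
have H : h^-1 *: ((g \o shift s) (h *: 1) - g s) @[h --> 0^'] --> l by rewrite -gl; exact: dg.
have /cvgrPdist_le/(_ _ e0)/nbhs_ballP[d /= d0 Hd] := H.
apply/nbhs_ballP; exists d => //= u su.
have [->|us] := eqVneq u s; first by rewrite !subrr mul0r subrr !normr0 mulr0.
have us0 : u - s != 0 by rewrite subr_eq0.
have := Hd (u - s); rewrite /ball/= sub0r normrN [X in X < d]distrC => /(_ su us0).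
rewrite /GRing.scale/= mulr1 subrK => K.
have -> : g u - g s - (u - s) * l = - ((l - (u - s)^-1 * (g u - g s)) * (u - s)).
  by field.
by rewrite normrN normrM ler_wpM2r.
Qed.

(** Turns a derivative along [v], at any point of a line of direction [v], into a
    derivative in one real variable, to which the mean value theorem and the
    fundamental theorem of calculus apply. *)
Lemma is_derive_line f x v s l :
  is_derive (x + s *: v) v f l <-> is_derive s 1 (fun s : R => f (x + s *: v)) l.
Proof.
have E : (fun h : R => h^-1 *: ((f \o shift (x + s *: v)) (h *: v) - f (x + s *: v))) =
  (fun h : R => h^-1 *: (((fun s : R => f (x + s *: v)) \o shift s) (h *: 1) - f (x + s *: v))).
  apply/funext => h; rewrite /= [h%:A](_ : _ = h); last exact: mulr1.
  rewrite scalerDl; congr (_ *: (f _ - _)).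
  by rewrite addrCA.
by split => -[d e]; split; move: d e; rewrite /derivable /derive E.
Qed.



Lemma is_derive_line0 f x v l :
  is_derive x v f l <-> is_derive (0 : R) 1 (fun s : R => f (x + s *: v)) l.
Proof. by rewrite -is_derive_line scale0r addr0. Qed.

(** Directional derivatives need not add up in general. They do when the one
    along [e] is continuous: moving first along [v] and then along [e], the second
    increment is by the mean value theorem a multiple of a value of ['D_e f]
    at a point that tends to [x]. *)
Lemma is_derive_add_direction f x v e (a l : R) :
  (forall y, derivable f y e) -> {for x, continuous (fun y => 'D_e f y)} ->
  is_derive x v f l -> is_derive x (v + a *: e) f (l + a * 'D_e f x).
Proof.
move=> dfe ce /is_derive_line0 /is_derive_estimateP dv.
apply/is_derive_line0/is_derive_estimate => eps eps0.
pose K := `|a| + 1.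
have K0 : 0 < K by rewrite ltr_wpDl.
have e1 : 0 < eps / 2 by rewrite divr_gt0.
have e2 : 0 < eps / 2 / K by rewrite divr_gt0.
have /cvgrPdist_lt/(_ _ e2)/nbhs_ballP[d /= d0 Hd] := ce.
pose L := `|v| + `|a| * `|e| + 1.
have L0 : 0 < L by rewrite ltr_wpDl// addr_ge0// mulr_ge0.
have dL0 : 0 < d / L by rewrite divr_gt0.
near=> u.
have [c [ca E]] := mean_value (f := fun t : R => f (x + u *: v + t *: e)) 0 (u * a)
  (fun t => (@is_derive_line f (x + u *: v) e t _).1 (derivableP (dfe _))).
rewrite !subr0 in ca E.
rewrite !scale0r !addr0 subr0 in E *.
have H1 : `|f (x + u *: v) - f x - u * l| <= eps / 2 * `|u|.
  have : `|f (x + u *: v) - f (x + 0 *: v) - (u - 0) * l| <= eps / 2 * `|u - 0|.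
    by near: u; exact: dv.
  by rewrite subr0 scale0r addr0.
have H2 : `|'D_e f x - 'D_e f (x + u *: v + c *: e)| < eps / 2 / K.
  apply: Hd; rewrite -ball_normE/= -addrA opprD addrA subrr sub0r normrN.
  rewrite (le_lt_trans (ler_normD _ _))// !normrZ.
  have uL : `|u| < d / L by near: u; exact: (@nbhs0_lt R R).
  apply: (@le_lt_trans _ _ (`|u| * L)); last by rewrite -ltr_pdivlMr.
  rewrite /L !mulrDr mulr1 -[leLHS]addr0 lerD// lerD2l mulrA ler_wpM2r//.
  by rewrite (le_trans ca)// normrM.
rewrite scalerDr addrA scalerA.
have -> : f (x + u *: v + (u * a) *: e) - f x - u * (l + a * 'D_e f x) =
  (f (x + u *: v) - f x - u * l) - u * a * ('D_e f x - 'D_e f (x + u *: v + c *: e)).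
  rewrite -[f (x + u *: v + (u * a) *: e)](subrK (f (x + u *: v))) E; ring.
rewrite (le_trans (ler_normB _ _))// [eps]splitr mulrDl lerD//.
rewrite normrM (le_trans (ler_wpM2l (normr_ge0 _) (ltW H2)))//.
rewrite normrM -mulrA mulrC ler_wpM2r// mulrCA -[leRHS]mulr1 ler_wpM2l ?(ltW e1)//.
by rewrite ler_pdivrMr// mul1r /K lerDl.
Unshelve. all: by end_near. Qed.

End Directional.
Arguments is_derive_line {R V} f x v s l.

(** * Smooth functions *)

Section Smooth.
Variables (R : realType) (d : nat).
Implicit Types (f g h : 'cV[R]_d -> R) (s w : seq 'I_d) (i : 'I_d).
Local Notation basis i := (delta_mx i 0 : 'cV[R]_d).

Lemma partials_cons i s g : partials (i :: s) g = partials s (partial g i).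
Proof. by []. Qed.

(** Coinduction: smoothness is the largest property of functions that entails
    continuity and the existence of the partial derivatives and is inherited by
    these. The closure properties of smooth functions follow from it without any
    induction on the word of derivations. *)
Lemma smoothP (P : ('cV[R]_d -> R) -> Prop) :
  (forall g, P g -> [/\ continuous g, forall i x, derivable g x (basis i) &
     forall i, P (partial g i)]) ->
  forall g, P g -> smooth g.
Proof.
move=> H g Pg s; elim: s g Pg => [|i s IH] g Pg.
  by have [cg dg _] := H _ Pg; split.
by rewrite partials_cons; apply: IH; have [_ _] := H _ Pg.
Qed.

Lemma smooth_continuous g : smooth g -> continuous g.
Proof. by move=> /(_ [::])[]. Qed.

Lemma smooth_derivable g : smooth g -> forall i x, derivable g x (basis i).
Proof. by move=> /(_ [::])[]. Qed.


Lemma smooth_partial g i : smooth g -> smooth (partial g i).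
Proof. by move=> sg s; have := sg (i :: s). Qed.

Lemma smooth_partials g s : smooth g -> smooth (partials s g).
Proof.
by elim: s g => [//|i s IH] g sg; rewrite partials_cons; apply/IH/smooth_partial.
Qed.

Lemma partial_cst (a : R) i : partial (fun=> a) i = fun=> 0.
Proof. by apply/funext => x; rewrite /partial derive_cst. Qed.

Lemma smooth_cst (a : R) : smooth (fun _ : 'cV[R]_d => a).
Proof.
apply: (@smoothP (fun g => exists a, g = fun=> a)); last by exists a.
move=> _ [b ->]; split; first exact: continuous_const.
  by move=> i x; exact: derivable_cst.
by move=> i; exists 0; rewrite partial_cst.
Qed.

Lemma partials0 s : partials s (fun _ : 'cV[R]_d => 0) = fun=> 0.
Proof. by elim: s => // i s IH; rewrite partials_cons partial_cst. Qed.

Lemma is_derive_lin (a : R) f g (x v : 'cV[R]_d) : derivable f x v -> derivable g x v ->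
  is_derive x v (fun y => a * f y + g y) (a * 'D_v f x + 'D_v g x).
Proof.
move=> df dg.
exact: (is_deriveD (is_deriveZ a (derivableP df)) (derivableP dg)).
Qed.

Lemma partial_lin (a : R) f g i : smooth f -> smooth g ->
  partial (fun x => a * f x + g x) i = fun x => a * partial f i x + partial g i x.
Proof.
move=> sf sg; apply/funext => x; rewrite /partial; apply: derive_val.
by apply: is_derive_lin; exact: smooth_derivable.
Qed.

Lemma smooth_lin (a : R) f g : smooth f -> smooth g -> smooth (fun x => a * f x + g x).
Proof.
move=> sf sg.
apply: (@smoothP (fun h => exists f g,
  [/\ smooth f, smooth g & h = fun x => a * f x + g x])); last by exists f, g.
move=> _ [{}f [{}g [{}sf {}sg ->]]]; split.
- apply: continuous_add; last exact: smooth_continuous.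
  by apply: continuous_mul; [exact: continuous_const|exact: smooth_continuous].
- move=> i x; apply: ex_derive; apply: is_derive_lin; exact: smooth_derivable.
- move=> i; exists (partial f i), (partial g i); split; try exact: smooth_partial.
  exact: partial_lin.
Qed.

Lemma partials_lin (a : R) f g s : smooth f -> smooth g ->
  partials s (fun x => a * f x + g x) = fun x => a * partials s f x + partials s g x.
Proof.
elim: s f g => [//|i s IH] f g sf sg.
by rewrite !partials_cons partial_lin// IH//; exact: smooth_partial.
Qed.

(** The Leibniz rule leads from a product to a sum of products, so that the
    property preserved by derivation is membership in the span of the products. *)
Inductive product_span : ('cV[R]_d -> R) -> Prop :=
| ProductSpan f g : smooth f -> smooth g -> product_span (fun x => f x * g x)
| ProductSpanD f g : product_span f -> product_span g -> product_span (fun x => f x + g x).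

Lemma smooth_mul f g : smooth f -> smooth g -> smooth (fun x => f x * g x).
Proof.
move=> sf sg; apply: (@smoothP product_span); last exact: ProductSpan.
move=> h; elim=> {f g sf sg h} [f g sf sg|f g _ [cf df pf] _ [cg dg pg]].
  have D i x : is_derive x (basis i) (fun y => f y * g y)
      (f x * partial g i x + partial f i x * g x).
    have := is_deriveM (derivableP (@smooth_derivable _ sf i x))
      (derivableP (@smooth_derivable _ sg i x)).
    by rewrite /GRing.scale/= [g x * _]mulrC.
  split.
  - by apply: continuous_mul; exact: smooth_continuous.
  - by move=> i x; apply: ex_derive.
  - move=> i; rewrite (_ : partial _ i = (fun x => f x * partial g i x + partial f i x * g x)).
      by apply: ProductSpanD; apply: ProductSpan => //; exact: smooth_partial.
    by apply/funext => x; apply: derive_val.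
split; first exact: continuous_add.
- by move=> i x; exact: derivableD.
- move=> i; rewrite (_ : partial _ i = (fun x => partial f i x + partial g i x)).
    exact: ProductSpanD.
  by apply/funext => x; rewrite /partial; exact: deriveD.
Qed.

Definition translate (T : Type) (k : 'cV[R]_d) (f : 'cV[R]_d -> T) : 'cV[R]_d -> T :=
  fun x => f (x - k).

Lemma derive_translate k f (x v : 'cV[R]_d) l :
  is_derive (x - k) v f l -> is_derive x v (translate k f) l.
Proof.
move=> /is_derive_line0 H; apply/is_derive_line0; rewrite /translate.
by under eq_fun do rewrite addrAC.
Qed.

Lemma partial_translate k f i : smooth f ->
  partial (translate k f) i = translate k (partial f i).
Proof.
move=> sf; apply/funext => x; rewrite /partial {2}/translate.
by apply: derive_val; apply: derive_translate; apply/derivableP/smooth_derivable.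
Qed.

Lemma continuous_translate k f : continuous f -> continuous (translate k f).
Proof.
rewrite /translate => cf; apply: (@continuous_then _ _ _ (fun x : 'cV[R]_d => x - k) f) => //.
by apply: continuous_add; [exact: continuous_ident|exact: continuous_const].
Qed.

Lemma smooth_translate k f : smooth f -> smooth (translate k f).
Proof.
move=> sf.
apply: (@smoothP (fun g => exists2 f, smooth f & g = translate k f)); last by exists f.
move=> _ [{}f {}sf ->]; split.
- by apply/continuous_translate/smooth_continuous.
- move=> i x; apply: ex_derive; apply: derive_translate.
  by apply/derivableP/smooth_derivable.
- by move=> i; exists (partial f i); [exact: smooth_partial|exact: partial_translate].
Qed.

Lemma partials_translate k f s : smooth f ->
  partials s (translate k f) = translate k (partials s f).
Proof.
elim: s f => [//|i s IH] f sf.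
by rewrite !partials_cons partial_translate// IH//; exact: smooth_partial.
Qed.

Lemma vanishes_translate A k f : vanishes_beyond A f -> vanishes_beyond (A + `|k|) (translate k f).
Proof.
move=> f0 x H; apply: f0; rewrite -(ltrD2r `|k|) (lt_le_trans H)//.
by rewrite -{1}[x](subrK k) ler_normD.
Qed.

Lemma vanishes_partial A f i : vanishes_beyond A f -> vanishes_beyond A (partial f i).
Proof.
move=> f0 x Ax; rewrite /partial -(derive_cst (0 : R) x (basis i)).
apply: near_eq_derive.
have xA : 0 < `|x| - A by rewrite subr_gt0.
apply/nbhs_ballP; exists (`|x| - A) => //= y; rewrite -ball_normE/= => xy.
apply: f0; rewrite ltrBrDl -ltrBrDr in xy.
by rewrite (lt_le_trans xy)// lerBlDl -lerBlDr (le_trans (lerB_dist _ _)).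
Qed.

(** All partial derivatives are continuous, so the coordinates of [v] can be
    added one at a time. *)
Lemma smooth_directional f (x v : 'cV[R]_d) : smooth f ->
  is_derive x v f (\sum_i v i 0 * partial f i x).
Proof.
move=> sf.
have -> : v = \sum_(i <- index_enum 'I_d) v i 0 *: basis i.
  apply/matrixP => i j; rewrite ord1 summxE (bigD1 i)//= !mxE !eqxx mulr1 big1 ?addr0//.
  by move=> k ki; rewrite !mxE eq_sym (negbTE ki) mulr0.
set w := \sum_(i <- _) _.
rewrite (_ : (\sum_i _) = \sum_(i <- index_enum 'I_d) v i 0 * partial f i x); last first.
  apply: eq_bigr => i _; congr (_ * _).
  rewrite /w summxE (bigD1 i)//= !mxE !eqxx mulr1 big1 ?addr0//.
  by move=> k ki; rewrite !mxE eq_sym (negbTE ki) mulr0.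
rewrite /w; elim: (index_enum _) => [|i r IH].
  by rewrite !big_nil; exact: is_derive0.
have ci : {for x, continuous (partial f i)} by exact: smooth_continuous (smooth_partial i sf) x.
have H := is_derive_add_direction (v i 0) (@smooth_derivable _ sf i) ci IH.
by rewrite !big_cons addrC [X in is_derive _ _ _ X]addrC.
Qed.

End Smooth.
Arguments smooth_derivable {R d g} sg i x.

(** * Families of smooth functions and their integrals *)

Section Families.
Variables (R : realType) (d : nat).
Notation mu := (@lebesgue_measure R).
Implicit Types (w : seq 'I_d) (i : 'I_d).
Local Notation basis i := (delta_mx i 0 : 'cV[R]_d).

(** Continuity of the derivatives jointly in the parameter and the point is what
    differentiating and integrating in the parameter under a distribution
    require; the parameter space may be any topological space. *)
Record smooth_family (U : topologicalType) (Phi : U -> 'cV[R]_d -> R) : Prop :=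
  SmoothFamily {
    family_smooth : forall u, smooth (Phi u) ;
    family_continuous : forall w, continuous (fun p : U * 'cV[R]_d => partials w (Phi p.1) p.2) }.
Arguments family_smooth {U Phi}.
Arguments family_continuous {U Phi}.

Lemma smooth_family_partial (U : topologicalType) (Phi : U -> 'cV[R]_d -> R) i :
  smooth_family Phi -> smooth_family (fun u => partial (Phi u) i).
Proof.
move=> [sP cP]; split.
- by move=> u; exact: smooth_partial.
- by move=> w; exact: (cP (i :: w)).
Qed.

Lemma smooth_family_comp (U V : topologicalType) (Phi : V -> 'cV[R]_d -> R) (f : U -> V) :
  continuous f -> smooth_family Phi -> smooth_family (fun u => Phi (f u)).
Proof.
move=> cf [sP cP]; split => // w.
apply: (@continuous_then _ _ _ (fun p : U * 'cV[R]_d => (f p.1, p.2))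
  (fun p : V * 'cV[R]_d => partials w (Phi p.1) p.2)) => //.
apply: continuous_pairing; last exact: continuous_proj2.
by apply: (@continuous_then _ _ _ fst f) => //; exact: continuous_proj1.
Qed.

Lemma family_slice_continuous (U : topologicalType) (Phi : U -> 'cV[R]_d -> R) w x :
  smooth_family Phi -> continuous (fun u => partials w (Phi u) x).
Proof.
move=> [_ cP].
apply: (@continuous_then _ _ _ (fun u : U => (u, x))
  (fun p : U * 'cV[R]_d => partials w (Phi p.1) p.2)) => //.
by apply: continuous_pairing; [exact: continuous_ident|exact: continuous_const].
Qed.

Section OneParameter.
Variables (a b : R).

Lemma is_derive_integral_family (Phi : R -> 'cV[R]_d -> R) i x : smooth_family Phi ->
  is_derive x (basis i) (fun x => \int[mu]_(t in `[a, b]) Phi t x)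
    (\int[mu]_(t in `[a, b]) partial (Phi t) i x).
Proof.
move=> sP; apply/is_derive_line0.
have cl (G : R -> 'cV[R]_d -> R) : smooth_family G ->
    continuous (fun p : R * R => G p.2 (x + p.1 *: basis i)).
  move=> sG; apply: (@continuous_then _ _ _ (fun p : R * R => (p.2, x + p.1 *: basis i))
    (fun p : R * 'cV[R]_d => partials [::] (G p.1) p.2)).
  - apply: continuous_pairing; first exact: continuous_proj2.
    apply: continuous_add; first exact: continuous_const.
    apply: continuous_scale; first exact: continuous_proj1.
    exact: continuous_const.
  - exact: (family_continuous sG [::]).
have := @derive_Rintegral_itv R (fun p => Phi p.2 (x + p.1 *: basis i))
  (fun p => partial (Phi p.2) i (x + p.1 *: basis i)) a b 0 _ (cl _ sP)
  (cl _ (smooth_family_partial i sP)).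
rewrite /= scale0r addr0; apply => s t.
have dP := derivableP (smooth_derivable (family_smooth sP t) i (x + s *: basis i)).
exact: ((is_derive_line (Phi t) x (basis i) s _).1 dP).
Qed.

Lemma partials_integral_family (Phi : R -> 'cV[R]_d -> R) w : smooth_family Phi ->
  partials w (fun x => \int[mu]_(t in `[a, b]) Phi t x) =
  fun x => \int[mu]_(t in `[a, b]) partials w (Phi t) x.
Proof.
elim: w Phi => [//|i w IH] Phi sP.
rewrite partials_cons (_ : partial _ i = fun x => \int[mu]_(t in `[a, b]) partial (Phi t) i x).
  exact: (IH _ (smooth_family_partial i sP)).
by apply/funext => x; have H := is_derive_integral_family i x sP; exact: derive_val.
Qed.

Lemma smooth_family_integral_itv (U : topologicalType) (Phi : U * R -> 'cV[R]_d -> R) :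
  smooth_family Phi ->
  smooth_family (fun u x => \int[mu]_(t in `[a, b]) Phi (u, t) x).
Proof.
move=> sP.
have sPu u : smooth_family (fun t => Phi (u, t)).
  apply: (smooth_family_comp (f := fun t : R => (u, t))) => //.
  by apply: continuous_pairing; [exact: continuous_const|exact: continuous_ident].
have cI w : continuous (fun p : U * 'cV[R]_d =>
    partials w (fun x => \int[mu]_(t in `[a, b]) Phi (p.1, t) x) p.2).
  under eq_fun do rewrite (partials_integral_family _ (sPu _)).
  apply: (@continuous_Rintegral_itv _ _
    (fun q : (U * 'cV[R]_d) * R => partials w (Phi (q.1.1, q.2)) q.1.2)).
  apply: (@continuous_then _ _ _ (fun q : (U * 'cV[R]_d) * R => ((q.1.1, q.2), q.1.2))
    (fun p : (U * R) * 'cV[R]_d => partials w (Phi p.1) p.2)); last exact: (family_continuous sP w).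
  apply: continuous_pairing; first apply: continuous_pairing.
  - by apply: (@continuous_then _ _ _ fst fst); exact: continuous_proj1.
  - exact: continuous_proj2.
  - by apply: (@continuous_then _ _ _ fst snd); [exact: continuous_proj1|exact: continuous_proj2].
split=> //.
- move=> u w; split.
    apply: (@continuous_then _ _ _ (fun x => (u, x)) (fun p : U * 'cV[R]_d =>
      partials w (fun x => \int[mu]_(t in `[a, b]) Phi (p.1, t) x) p.2)) => //.
    by apply: continuous_pairing; [exact: continuous_const|exact: continuous_ident].
  move=> i x; rewrite (partials_integral_family _ (sPu _)).
  apply: ex_derive; apply: (is_derive_integral_family (Phi := fun t => partials w (Phi (u, t)))).
  elim: w {x} (Phi) sP {cI sPu} => [|j w IH] Psi sPsi.
    apply: (smooth_family_comp (f := fun t : R => (u, t))) => //.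
    by apply: continuous_pairing; [exact: continuous_const|exact: continuous_ident].
  exact: (IH _ (smooth_family_partial j sPsi)).
Qed.

End OneParameter.

Lemma smooth_family_integral_line (U : topologicalType) B (Phi : U * R -> 'cV[R]_d -> R) :
  smooth_family Phi -> (forall u x, vanishes_beyond B (fun t => Phi (u, t) x)) ->
  smooth_family (fun u x => \int[mu]_(t in [set: R]) Phi (u, t) x).
Proof.
move=> sP vP; rewrite (_ : (fun u => _) = (fun u x => \int[mu]_(t in `[- B, B]) Phi (u, t) x)).
  exact: smooth_family_integral_itv.
by apply/funext => u; apply/funext => x; exact: Rintegral_line_norm.
Qed.

(** The coordinates of [h] move one after the other into the parameter space. *)
Lemma smooth_family_integral_Rn (U : topologicalType) k B (Phi : U * 'cV[R]_k -> 'cV[R]_d -> R) :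
  smooth_family Phi -> (forall u x, vanishes_beyond B (fun h => Phi (u, h) x)) ->
  smooth_family (fun u x => integral_Rn (fun h => Phi (u, h) x)).
Proof.
elim: k U Phi => [|k IH] U Phi sP vP.
  apply: (smooth_family_comp (f := fun u => (u, 0 : 'cV[R]_0)) (Phi := Phi)) => //.
  by apply: continuous_pairing; [exact: continuous_ident|exact: continuous_const].
apply: (@smooth_family_integral_line U B
  (fun ut x => integral_Rn (fun h => Phi (ut.1, cons_col ut.2 h) x))).
  apply: (IH _ (fun q => Phi (q.1.1, cons_col q.1.2 q.2))).
    apply: (smooth_family_comp
      (f := fun q : (U * R) * 'cV[R]_k => (q.1.1, cons_col q.1.2 q.2))) => //.
    apply: continuous_pairing.
      by apply: (@continuous_then _ _ _ fst fst); exact: continuous_proj1.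
    apply: (@continuous_cons_col _ _ _ (fun p : (U * R) * 'cV[R]_k => p.1.2) snd);
      last exact: continuous_proj2.
    by apply: (@continuous_then _ _ _ fst snd); [exact: continuous_proj1|exact: continuous_proj2].
  by move=> [u t] x; exact: (vanishes_cons_col (g := fun h => Phi (u, h) x)).
by move=> u x; exact: (vanishes_integral_Rn (g := fun h => Phi (u, h) x)).
Qed.

Lemma smooth_lincomb (r : seq 'I_d) (v : 'cV[R]_d) (F : 'I_d -> 'cV[R]_d -> R) :
  (forall i, smooth (F i)) -> smooth (fun x => \sum_(i <- r) v i 0 * F i x).
Proof.
move=> sF; elim: r => [|i r IH].
  by under eq_fun do rewrite big_nil; exact: smooth_cst.
by under eq_fun do rewrite big_cons; exact: smooth_lin.
Qed.

Definition directional (v : 'cV[R]_d) (f : 'cV[R]_d -> R) : 'cV[R]_d -> R :=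
  fun x => \sum_i v i 0 * partial f i x.

Lemma smooth_family_translate (k : R -> 'cV[R]_d) f : continuous k -> smooth f ->
  smooth_family (fun s => translate (k s) f).
Proof.
move=> ck sf; split; first by move=> s; exact: smooth_translate.
move=> w; under eq_fun do rewrite partials_translate// /translate.
apply: (@continuous_then _ _ _ (fun p : R * 'cV[R]_d => p.2 - k p.1) (partials w f)).
  apply: continuous_add; first exact: continuous_proj2.
  apply: continuous_opp; apply: (@continuous_then _ _ _ fst k) => //.
  exact: continuous_proj1.
by apply: smooth_continuous; exact: smooth_partials.
Qed.

(** Partial derivatives commute with the derivative along [v]. Along the line of
    direction [v], [f] is the integral of [directional v f]; the partial
    derivatives pass under this integral, and the fundamental theorem of calculus
    recovers the integrand. Iterated limits never have to be exchanged by hand. *)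
Lemma directional_partials f (v x : 'cV[R]_d) w : smooth f ->
  is_derive x v (partials w f) (partials w (directional v f) x).
Proof.
move=> sf; pose D := directional v f.
have sD : smooth D by apply: smooth_lincomb => i; exact: smooth_partial.
have ck : continuous (fun t : R => - (t *: v)).
  apply: continuous_opp; apply: continuous_scale; first exact: continuous_ident.
  exact: continuous_const.
have sT := smooth_family_translate ck sD.
have cD w' y : continuous (fun t : R => partials w' (translate (- (t *: v)) D) y).
  exact: family_slice_continuous sT.
(* Any lower limit below 0 would do: the derivative is taken at s = 0. *)
have E s : -1 <= s -> translate (- (s *: v)) f =
    fun y => 1 * translate v f y + \int[mu]_(t in `[-1, s]) translate (- (t *: v)) D y.
  move=> s1; apply/funext => y; rewrite mul1r.
  have -> : \int[mu]_(t in `[-1, s]) translate (- (t *: v)) D y =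
      f (y + s *: v) - f (y + (-1) *: v).
    apply: (@Rintegral_FTC R _ (fun s => f (y + s *: v))) => // [|t _]; first exact: (cD [::]).
    apply: (is_derive_line f y v t _).1; rewrite /translate opprK; exact: smooth_directional.
  by rewrite /translate opprK scaleN1r; ring.
have E2 s : -1 <= s -> partials w f (x + s *: v) =
    partials w f (x - v) + \int[mu]_(t in `[-1, s]) partials w (translate (- (t *: v)) D) x.
  move=> s1; have := congr1 (fun g => partials w g x) (E s s1).
  rewrite partials_translate// partials_lin; last 2 first.
  - exact: smooth_translate.
  - have sTT : smooth_family (fun p : R * R => translate (- (p.2 *: v)) D).
      by apply: (smooth_family_comp (f := snd)) sT; exact: continuous_proj2.
    exact: (family_smooth (smooth_family_integral_itv (-1) s sTT) 0).
  rewrite partials_integral_family//.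
  by rewrite partials_translate// mul1r {1}/translate opprK.
apply/is_derive_line0.
apply: (@near_eq_is_derive _ _ _ (fun s : R => partials w f (x - v) +
  \int[mu]_(t in `[-1, s]) partials w (translate (- (t *: v)) D) x : R)).
  near=> s; rewrite E2//.
  have : -1 < s by near: s; apply: lt_nbhsr; rewrite ltrN10.
  exact: ltW.
have H := @derive_upper_limit R _ (-1) 0 (cD w x) (ltrN10 _).
have := is_deriveD (is_derive_cst (partials w f (x - v)) (0 : R) 1) H.
by rewrite add0r partials_translate// /translate scale0r oppr0 subr0.
Unshelve. all: by end_near. Qed.

(** * Test functions and distributions over the reals *)

Definition real_test (phi : 'cV[R]_d -> R) : Prop :=
  smooth phi /\ exists A, vanishes_beyond A phi.

Lemma vanishes_beyond_le (V : normedModType R) (A B : R) (f : V -> R) :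
  A <= B -> vanishes_beyond A f -> vanishes_beyond B f.
Proof. by move=> AB f0 x Bx; apply: f0; exact: le_lt_trans Bx. Qed.

Lemma real_test_lin a (phi psi : 'cV[R]_d -> R) :
  real_test phi -> real_test psi -> real_test (fun x => a * phi x + psi x).
Proof.
move=> [s1 [A vA]] [s2 [B vB]]; split; first exact: smooth_lin.
exists (Num.max A B) => x; rewrite gt_max => /andP[hA hB].
by rewrite vA// vB// mulr0 addr0.
Qed.

Lemma real_test_partial (phi : 'cV[R]_d -> R) i : real_test phi -> real_test (partial phi i).
Proof.
by move=> [s1 [A vA]]; split; [exact: smooth_partial|exists A; exact: vanishes_partial].
Qed.

Lemma real_test_translate (phi : 'cV[R]_d -> R) k : real_test phi -> real_test (translate k phi).
Proof.
move=> [s1 [A vA]]; split; first exact: smooth_translate.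
by exists (A + `|k|); exact: vanishes_translate.
Qed.

(** The classical seminorm estimate, with balls as the compact sets. *)
Record real_distribution (T : ('cV[R]_d -> R) -> R) : Prop := RealDistribution {
  rdist_lin : forall a phi psi, real_test phi -> real_test psi ->
    T (fun x => a * phi x + psi x) = a * T phi + T psi ;
  rdist_bound : forall A, exists C N, forall phi M, smooth phi -> vanishes_beyond A phi ->
    (forall w x, (size w <= N)%N -> `|partials w phi x| <= M) -> `|T phi| <= C * M }.

Lemma real_test0 : real_test (fun=> 0).
Proof. by split; [exact: smooth_cst|exists 0]. Qed.

Lemma rdist0 T : real_distribution T -> T (fun=> 0) = 0.
Proof.
move=> rT; have := rdist_lin rT 1 real_test0 real_test0.
have -> : (fun _ : 'cV[R]_d => 1 * 0 + 0 : R) = fun=> 0 by apply/funext => x; rewrite mulr0 addr0.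
by rewrite mul1r => /eqP; rewrite -subr_eq0 opprD addrA subrr sub0r oppr_eq0 => /eqP.
Qed.

Lemma rdistZ T a phi : real_distribution T -> real_test phi ->
  T (fun x => a * phi x) = a * T phi.
Proof.
move=> rT tp; rewrite -[RHS]addr0 -[X in _ + X](rdist0 rT) -rdist_lin//.
  by congr T; apply/funext => x; rewrite addr0.
exact: real_test0.
Qed.

(** A smooth family with locally bounded supports is continuous for every
    seminorm of the space of test functions. *)
Lemma near_partials_family (U : topologicalType) A (Phi : U -> 'cV[R]_d -> R) (u0 : U) N e :
  smooth_family Phi -> (\forall u \near u0, vanishes_beyond A (Phi u)) -> 0 < e ->
  \forall u \near u0, forall w x, (size w <= N)%N ->
    `|partials w (Phi u) x - partials w (Phi u0) x| < e.
Proof.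
move=> sP vP e0; elim: N Phi sP vP => [|N IH] Phi sP vP.
  have vP0 := nbhs_singleton vP.
  have := tube u0 (@compact_ball_cV R d A) (family_continuous sP [::]) e0.
  apply: filterS2 vP => u vu H [|//] x _.
  have [xA|xA] := leP `|x| A; first exact: H.
  by rewrite /= vu// vP0// subrr normr0.
have H1 : \forall u \near u0, forall i w x, (size w <= N)%N ->
    `|partials w (partial (Phi u) i) x - partials w (partial (Phi u0) i) x| < e.
  apply: filter_forall => i; apply: (IH _ (smooth_family_partial i sP)).
  by apply: filterS vP => u; exact: vanishes_partial.
have H0 := IH _ sP vP; near=> u => -[|i w] x wN.
  by have : forall w x, (size w <= N)%N ->
    `|partials w (Phi u) x - partials w (Phi u0) x| < e by [near: u]; apply.
rewrite !partials_cons.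
have : forall i w x, (size w <= N)%N ->
    `|partials w (partial (Phi u) i) x - partials w (partial (Phi u0) i) x| < e by near: u.
by apply.
Unshelve. all: by end_near. Qed.

Lemma rdist_continuous_family T (U : topologicalType) A (Phi : U -> 'cV[R]_d -> R) :
  real_distribution T -> smooth_family Phi -> (forall u, vanishes_beyond A (Phi u)) ->
  continuous (fun u => T (Phi u)).
Proof.
move=> rT sP vP u0; have [C [N HC]] := rdist_bound rT A.
apply/cvgrPdist_lt => e e0.
have e'0 : 0 < e / (`|C| + 1) by rewrite divr_gt0// ltr_wpDl.
have vn : \forall u \near u0, vanishes_beyond A (Phi u) by exact: nearW.
apply: filterS (near_partials_family N sP vn e'0) => u Hu.
have tu v : real_test (Phi v) by split; [exact: family_smooth sP v|exists A].
have -> : T (Phi u0) - T (Phi u) = T (fun x => -1 * Phi u x + Phi u0 x).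
  by rewrite rdist_lin// mulN1r addrC.
have su v := family_smooth sP v.
apply: le_lt_trans (HC _ (e / (`|C| + 1)) _ _ _) _.
- exact: smooth_lin.
- by move=> x Ax; rewrite !vP// mulr0 addr0.
- move=> w x wN; rewrite partials_lin// mulN1r addrC distrC ltW//; exact: Hu.
rewrite mulrCA -[ltRHS]mulr1 ltr_pM2l// ltr_pdivrMr ?mul1r; last by rewrite ltr_wpDl.
by rewrite (le_lt_trans (ler_norm _))// ltrDl.
Qed.

(** By the mean value theorem, every partial derivative of
    [Psi u - Psi s0 - (u - s0) Theta s0] is [u - s0] times a variation of a partial
    derivative of [Theta] near [s0], hence negligible with respect to [u - s0] in
    every seminorm; the continuity of [T] carries this over to values of [T]. *)
Lemma rdist_derive_family T (s0 A : R) (Psi Theta : R -> 'cV[R]_d -> R) :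
  real_distribution T -> smooth_family Theta -> (forall s, smooth (Psi s)) ->
  (\forall s \near s0, vanishes_beyond A (Psi s) /\ vanishes_beyond A (Theta s)) ->
  (forall w x (s : R), is_derive s 1 (fun s => partials w (Psi s) x) (partials w (Theta s) x)) ->
  is_derive s0 1 (fun s => T (Psi s)) (T (Theta s0)).
Proof.
move=> rT sT sPsi vv dPsi; have [C [N HC]] := rdist_bound rT A.
apply: is_derive_estimate => e e0.
have e'0 : 0 < e / (`|C| + 1) by rewrite divr_gt0// ltr_wpDl.
have vT : \forall s \near s0, vanishes_beyond A (Theta s) by apply: filterS vv => s [].
have Hn := near_partials_family N sT vT e'0.
have HI : \forall s \near s0, (vanishes_beyond A (Psi s) /\ vanishes_beyond A (Theta s)) /\
    forall w x, (size w <= N)%N ->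
      `|partials w (Theta s) x - partials w (Theta s0) x| < e / (`|C| + 1).
  by apply: filterI.
have /nbhs_ballP[r /= r0 Hr] := HI.
have [vs0 vt0] := nbhs_singleton vv.
apply/nbhs_ballP; exists r => //= u su.
have [[vu _] _] := Hr _ su.
have sTh := family_smooth sT.
have tP0 : real_test (Psi s0) by split => //; exists A.
have tPu : real_test (Psi u) by split => //; exists A.
have tT0 : real_test (Theta s0) by split => //; exists A.
have -> : T (Psi u) - T (Psi s0) - (u - s0) * T (Theta s0) =
    T (fun x => - (u - s0) * Theta s0 x + (-1 * Psi s0 x + Psi u x)).
  rewrite !rdist_lin//; first by ring.
  exact: real_test_lin.
apply: le_trans (HC _ (e / (`|C| + 1) * `|u - s0|) _ _ _) _.
- by apply: smooth_lin => //; exact: smooth_lin.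
- by move=> x Ax; rewrite vt0// vs0// vu// !mulr0 !addr0.
- move=> w x wN; rewrite !partials_lin//; last exact: smooth_lin.
  have [c [cs E]] := mean_value s0 u (dPsi w x).
  rewrite mulN1r [- _ + _]addrC E mulNr [_ * (u - s0)]mulrC addrC -mulrBr normrM mulrC.
  rewrite ler_wpM2r// ltW//.
  have [|_ Hc] := Hr c; last exact: Hc.
  by rewrite /ball/= distrC (le_lt_trans cs)// distrC.
rewrite mulrA ler_wpM2r// mulrCA -[leRHS]mulr1 ler_wpM2l ?(ltW e0)//.
by rewrite ler_pdivrMr ?mul1r ?ltr_wpDl// (le_trans (ler_norm _))// lerDl.
Qed.

(** Both sides are values at the upper end of functions of the upper limit of
    integration that start from zero and have the same derivative
    [T (Theta s)]. *)
Lemma rdist_integral_line T A B (Theta : R -> 'cV[R]_d -> R) :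
  real_distribution T -> smooth_family Theta -> (forall t, vanishes_beyond A (Theta t)) ->
  (forall x, vanishes_beyond B (fun t => Theta t x)) ->
  T (fun x => \int[mu]_(t in [set: R]) Theta t x) = \int[mu]_(t in [set: R]) T (Theta t).
Proof.
move=> rT sT vA vT.
have cT : continuous (fun t => T (Theta t)) by exact: rdist_continuous_family rT sT vA.
(* The margin of one makes the antiderivative Psi vanish near its lower limit,
   so that it is differentiable on the whole line. *)
pose b := `|B| + 1; have Bb : `|B| < b by rewrite ltrDl.
have b0 : 0 <= b by rewrite addr_ge0.
have T0 t : `|B| < `|t| -> Theta t = fun=> 0.
  move=> Bt; apply/funext => x; apply: vT; apply: le_lt_trans Bt; exact: ler_norm.
have vTT : vanishes_beyond b (fun t => T (Theta t)).
  by move=> t bt; rewrite T0 ?rdist0//; exact: lt_trans bt.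
rewrite (Rintegral_line_norm vTT).
have -> : (fun x => \int[mu]_(t in [set: R]) Theta t x) =
    fun x => \int[mu]_(t in `[- b, b]) Theta t x.
  apply/funext => x; apply: Rintegral_line_norm.
  apply: vanishes_beyond_le (vT x); rewrite (le_trans (ler_norm _))// ltW//.
pose Psi s x := \int[mu]_(t in `[- b, s]) Theta t x.
have cTw w x : continuous (fun t => partials w (Theta t) x).
  exact: family_slice_continuous sT.
have sPsi s : smooth (Psi s).
  have sc : smooth_family (fun p : R * R => Theta p.2).
    by apply: (smooth_family_comp (f := fun p : R * R => p.2)) => //; exact: continuous_proj2.
  exact: (family_smooth (smooth_family_integral_itv (- b) s sc) 0).
have vPsi s : vanishes_beyond A (Psi s).
  move=> x Ax; rewrite /Psi (_ : (fun t => _) = fun=> 0) ?/Rintegral ?integral0//.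
  by apply/funext => t; exact: vA.
have dPsi w x (s : R) : - b < s ->
    is_derive s 1 (fun s => partials w (Psi s) x) (partials w (Theta s) x).
  move=> bs; under eq_fun do rewrite (partials_integral_family _ _ _ sT).
  exact: (derive_upper_limit (cTw w x)).
have Psi0 s : s < - `|B| -> Psi s = fun=> 0.
  move=> sB; apply/funext => x; rewrite /Psi.
  have -> : \int[mu]_(t in `[- b, s]) Theta t x = \int[mu]_(t in `[- b, s]) 0.
    apply: eq_Rintegral => t; rewrite inE/= in_itv/= => /andP[_ ts].
    rewrite T0// ltNge ler_norml negb_and -!ltNge; apply/orP; left; lra.
  by rewrite /Rintegral integral0.
have dPsiT w x (s : R) : is_derive s 1 (fun s => partials w (Psi s) x) (partials w (Theta s) x).
  have [bs|sb] := ltP (- b) s; first exact: dPsi.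
  have sB : s < - `|B| by rewrite (le_lt_trans sb)// ltrN2.
  rewrite (T0 s) ?partials0; last by rewrite ltNge ler_norml negb_and -!ltNge sB.
  apply: (@near_eq_is_derive _ _ _ (fun _ : R => 0 : R)).
  near=> u; rewrite Psi0 ?partials0//; near: u.
  exact: lt_nbhsl.
have dT (s : R) : is_derive s 1 (fun s => T (Psi s)) (T (Theta s)).
  have vv : \forall u \near s, vanishes_beyond A (Psi u) /\ vanishes_beyond A (Theta u).
    by near=> u; split.
  exact: (rdist_derive_family rT sT sPsi vv dPsiT).
have -> : \int[mu]_(t in `[- b, b]) T (Theta t) = T (Psi b) - T (Psi (- b)).
  by apply: Rintegral_FTC => //; lra.
have -> : Psi (- b) = fun=> 0.
  by apply/funext => x; rewrite /Psi set_itv1 Rintegral_set1.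
by rewrite rdist0// subr0.
Unshelve. all: by end_near. Qed.

(** A distribution commutes with integration in a parameter, one coordinate of
    the parameter at a time. *)
Theorem rdist_integral_Rn T k A B (Phi : 'cV[R]_k -> 'cV[R]_d -> R) :
  real_distribution T -> smooth_family Phi -> (forall h, vanishes_beyond A (Phi h)) ->
  (forall x, vanishes_beyond B (fun h => Phi h x)) ->
  T (fun x => integral_Rn (fun h => Phi h x)) = integral_Rn (fun h => T (Phi h)).
Proof.
move=> rT; elim: k Phi => [//|k IH] Phi sP vA vP.
have cc : continuous (fun q : R * 'cV[R]_k => cons_col q.1 q.2).
  by apply: (@continuous_cons_col _ _ _ fst snd); [exact: continuous_proj1|exact: continuous_proj2].
have sI : smooth_family (fun t x => integral_Rn (fun h => Phi (cons_col t h) x)).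
  apply: (@smooth_family_integral_Rn _ _ B (fun q : R * 'cV[R]_k => Phi (cons_col q.1 q.2))).
    exact: (smooth_family_comp cc sP).
  by move=> t x; exact: (vanishes_cons_col (g := fun h => Phi h x)).
rewrite integral_RnS.
transitivity (\int[mu]_(t in [set: R]) T (fun x => integral_Rn (fun h => Phi (cons_col t h) x))).
  apply: (rdist_integral_line (A := A) (B := B) rT sI) => [t x Ax|x].
    rewrite -[RHS](@integral_Rn0 R k); congr integral_Rn.
    by apply/funext => h; exact: vA.
  exact: (vanishes_integral_Rn (g := fun h => Phi h x)).
congr (Rintegral _ _ _); apply/funext => t; apply: (IH (fun h => Phi (cons_col t h))).
  apply: (smooth_family_comp (f := fun h => cons_col t h)) => //.
  by apply: (@continuous_cons_col _ _ _ (fun=> t) id);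
  [exact: continuous_const|exact: continuous_ident].
  by move=> h; exact: vA.
by move=> x; exact: (vanishes_cons_col (g := fun h => Phi h x)).
Qed.

End Families.

(** * Translates of a test function *)

Section Orbits.
Variables (R : realType) (d : nat).
Notation mu := (@lebesgue_measure R).
Implicit Types (w : seq 'I_d) (i : 'I_d) (T : ('cV[R]_d -> R) -> R).
Local Notation basis i := (delta_mx i 0 : 'cV[R]_d).

Lemma real_test_lincomb (r : seq 'I_d) (v : 'cV[R]_d) (F : 'I_d -> 'cV[R]_d -> R) :
  (forall i, real_test (F i)) -> real_test (fun x => \sum_(i <- r) v i 0 * F i x).
Proof.
move=> sF; elim: r => [|i r IH].
  by under eq_fun do rewrite big_nil; exact: real_test0.
by under eq_fun do rewrite big_cons; exact: real_test_lin.
Qed.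

Lemma rdist_lincomb T (r : seq 'I_d) (v : 'cV[R]_d) (F : 'I_d -> 'cV[R]_d -> R) :
  real_distribution T -> (forall i, real_test (F i)) ->
  T (fun x => \sum_(i <- r) v i 0 * F i x) = \sum_(i <- r) v i 0 * T (F i).
Proof.
move=> rT sF; elim: r => [|i r IH].
  by under eq_fun do rewrite big_nil; rewrite rdist0// big_nil.
under eq_fun do rewrite big_cons; rewrite rdist_lin//; last exact: real_test_lincomb.
by rewrite big_cons IH.
Qed.

Lemma rdist_derive_orbit T psi (y : 'cV[R]_d) (s : R) :
  real_distribution T -> real_test psi ->
  is_derive s 1 (fun s => T (translate (s *: y) psi))
    (- \sum_i y i 0 * T (translate (s *: y) (partial psi i))).
Proof.
move=> rT tpsi; have [spsi [A vpsi]] := tpsi.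
pose D := directional (- y) psi.
have sD : smooth D by apply: smooth_lincomb => i; exact: smooth_partial.
have vD : vanishes_beyond A D.
  move=> x Ax; rewrite /D /directional big1// => i _.
  by rewrite (vanishes_partial i vpsi)// mulr0.
have -> : - (\sum_i y i 0 * T (translate (s *: y) (partial psi i))) = T (translate (s *: y) D).
  rewrite /translate /D /directional (rdist_lincomb _ _ rT) => [|i]; last first.
    exact: real_test_translate (real_test_partial i tpsi).
  by rewrite -sumrN; apply: eq_bigr => i _; rewrite !mxE mulNr.
have cy : continuous (fun s : R => s *: y).
  by apply: continuous_scale; [exact: continuous_ident|exact: continuous_const].
pose A' := A + (`|s| + 1) * `|y|.
have vv : \forall u \near s, vanishes_beyond A' (translate (u *: y) psi) /\
    vanishes_beyond A' (translate (u *: y) D).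
  have : \forall u \near s, `|s - u| < 1.
    by apply/nbhs_ballP; exists 1 => //= u.
  apply: filterS => u us.
  have H : A + `|u *: y| <= A'.
    rewrite lerD2l normrZ ler_wpM2r// -[u](subrK s) addrC (le_trans (ler_normD _ _))//.
    by rewrite lerD2l distrC ltW.
  by split; apply: vanishes_beyond_le H _; exact: vanishes_translate.
have dd w x (t : R) : is_derive t 1 (fun s : R => partials w (translate (s *: y) psi) x)
    (partials w (translate (t *: y) D) x).
  rewrite partials_translate// {2}/translate.
  under eq_fun do rewrite partials_translate// /translate -scalerN.
  apply: (is_derive_line (partials w psi) x (- y) t _).1.
  by rewrite -scalerN; exact: directional_partials.
exact: (@rdist_derive_family R d T s A' (fun s => translate (s *: y) psi)
  (fun s => translate (s *: y) D) rT (smooth_family_translate cy sD)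
  (fun u => smooth_translate (u *: y) spsi) vv dd).
Qed.

Lemma rdist_partial T i : real_distribution T -> real_distribution (fun phi => T (partial phi i)).
Proof.
move=> rT; split.
- move=> a phi psi tphi tpsi; rewrite partial_lin; [|by case: tphi|by case: tpsi].
  by rewrite rdist_lin//; exact: real_test_partial.
- move=> A; have [C [N HC]] := rdist_bound rT A; exists C, N.+1 => phi M sphi vphi HM.
  apply: HC; [exact: smooth_partial|exact: vanishes_partial|].
  by move=> w x wN; apply: (HM (i :: w)).
Qed.

Fixpoint differences (l : seq 'cV[R]_d) (phi : 'cV[R]_d -> R) : 'cV[R]_d -> R :=
  if l is h :: l' then fun x => differences l' phi (x - h) - differences l' phi x else phi.

Lemma real_test_sub (phi psi : 'cV[R]_d -> R) :
  real_test phi -> real_test psi -> real_test (fun x => phi x - psi x).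
Proof.
move=> tphi tpsi; under eq_fun do rewrite addrC -mulN1r; exact: real_test_lin.
Qed.

Lemma rdist_sub T (phi psi : 'cV[R]_d -> R) : real_distribution T ->
  real_test phi -> real_test psi -> T (fun x => phi x - psi x) = T phi - T psi.
Proof.
move=> rT tphi tpsi; under eq_fun do rewrite addrC -mulN1r.
by rewrite rdist_lin// mulN1r addrC.
Qed.

Lemma real_test_differences l phi : real_test phi -> real_test (differences l phi).
Proof.
move=> tphi; elim: l => [//|h l IH]; apply: real_test_sub => //.
exact: (real_test_translate h IH).
Qed.

Definition annihilates_differences (n : nat) T : Prop :=
  forall l phi, size l = n -> real_test phi -> T (differences l phi) = 0.

(** If [D] is an iterated difference of [phi] of length [n], then [T] takes the
    same value on all translates of [D] along a coordinate axis, so its derivative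
    in that direction vanishes at [D]. *)
Lemma annihilates_partial T n i : real_distribution T ->
  annihilates_differences n.+1 T -> annihilates_differences n (fun phi => T (partial phi i)).
Proof.
move=> rT aT l phi ln tphi; have tD := real_test_differences l tphi.
have H := rdist_derive_orbit (basis i) 0 rT tD.
have E : (fun s : R => T (translate (s *: basis i) (differences l phi))) =
    fun=> T (differences l phi).
  apply/funext => s; apply/eqP; rewrite -subr_eq0 -rdist_sub//; last exact: real_test_translate.
  by apply/eqP; apply: (aT (s *: basis i :: l)) => //=; rewrite ln.
rewrite E in H; have := derive_val (is_derive := H); rewrite derive_cst => /eqP.
rewrite eq_sym oppr_eq0 (bigD1 i)//= big1 ?addr0 => [|j ji]; last first.
  by rewrite !mxE (negbTE ji) mul0r.
rewrite mxE !eqxx mul1r scale0r => /eqP <-; congr T; apply/funext => x.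
by rewrite /translate subr0.
Qed.

Definition peval (p : mpoly.mpoly d R) (x : 'cV[R]_d) : R := mpoly.meval (fun i => x i 0) p.

Lemma pevalE p x : peval p x =
  \sum_(m <- mpoly.msupp p) mpoly.mcoeff m p * \prod_i x i 0 ^+ m i.
Proof. exact: mpoly.mevalE. Qed.

Lemma monomial_scale (m : mpoly.multinom d) (s : R) (y : 'cV[R]_d) :
  \prod_i ((s *: y) i 0) ^+ m i = s ^+ (mpoly.mdeg m) * \prod_i y i 0 ^+ m i.
Proof.
under eq_bigr do rewrite mxE exprMn; rewrite big_split/=; congr (_ * _).
by rewrite mpoly.mdegE; elim/big_ind2: _ => // a b c e -> ->; rewrite exprD.
Qed.

(** Dividing the terms of degree [k] of [p] by [k + 1] gives [q]; then
    [s * q (s y)] is the antiderivative of [p] along the ray through [y] that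
    vanishes at the origin. *)
Lemma radial_antiderivative (p : mpoly.mpoly d R) : exists q : mpoly.mpoly d R,
  (mpoly.msize q <= mpoly.msize p)%N /\
  forall (y : 'cV[R]_d) (s : R),
    is_derive s 1 (fun s => s * peval q (s *: y)) (peval p (s *: y)).
Proof.
pose c m := (mpoly.mdeg m).+1%:R^-1 * mpoly.mcoeff m p : R.
exists (\sum_(m <- mpoly.msupp p) GRing.scale (c m) (@mpoly.mpolyX d R m)); split.
  apply: (leq_trans (mpoly.msize_sum _ _ _)); rewrite big_seq; apply/bigmax_leqP_seq => m _ mp.
  apply: (leq_trans (mpoly.msizeZ_le _ _)); rewrite mpoly.msizeX.
  exact: mpoly.msize_mdeg_lt.
move=> y s.
have E t : t * peval (\sum_(m <- mpoly.msupp p) GRing.scale (c m) (@mpoly.mpolyX d R m)) (t *: y) =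
    \sum_(m <- mpoly.msupp p) c m * (\prod_i y i 0 ^+ m i) * t ^+ (mpoly.mdeg m).+1.
  rewrite /peval raddf_sum mulr_sumr; apply: eq_bigr => m _.
  by rewrite /= mpoly.mevalZ mpoly.mevalX monomial_scale exprS; ring.
under eq_fun do rewrite E.
rewrite pevalE; elim: (mpoly.msupp p) => [|m r IH].
  by rewrite big_nil; under eq_fun do rewrite big_nil; exact: is_derive_cst.
rewrite big_cons; under eq_fun do rewrite big_cons.
set K := \prod_i y i 0 ^+ m i.
have H : is_derive s 1 (fun t => c m * K * t ^+ (mpoly.mdeg m).+1)
    (mpoly.mcoeff m p * \prod_i (s *: y) i 0 ^+ m i).
  have H := is_deriveZ (c m * K) (is_deriveX (mpoly.mdeg m).+1 (is_derive_id s (1 : R))).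
  rewrite exprfctE in H; apply: (is_derive_eq H).
  rewrite monomial_scale -/K /GRing.scale/= mulr1 /c -mulr_natl; field.
  by rewrite ?natr1 ?nat1r pnatr_eq0.
exact: is_deriveD.
Qed.

(** The derivative of [y |-> T (translate y psi)] in the [i]-th coordinate is, up
    to sign, the same function for [T] composed with the [i]-th partial derivative
    and [psi]. By induction these are polynomials of size at most [n]; integrating
    along rays adds one to the degree. *)
Lemma orbit_polynomial T n psi : real_distribution T -> annihilates_differences n T ->
  real_test psi -> exists p : mpoly.mpoly d R, (mpoly.msize p <= n)%N /\
    forall y, T (translate y psi) = peval p y.
Proof.
elim: n T psi => [|n IH] T psi rT aT tpsi.
  exists 0; rewrite mpoly.msize0; split=> // y.
  rewrite /peval mpoly.meval0; apply: (aT [::]) => //; exact: real_test_translate.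
have /choice[q Hq] : forall i, exists q : mpoly.mpoly d R, (mpoly.msize q <= n)%N /\
    forall (y : 'cV[R]_d) (s : R), is_derive s 1 (fun s : R => s * peval q (s *: y))
      (T (translate (s *: y) (partial psi i))).
  move=> i.
  have [p [pn Hp]] := IH _ psi (rdist_partial i rT) (annihilates_partial i rT aT) tpsi.
  have [q [qp Hq]] := radial_antiderivative p.
  exists q; split; first exact: leq_trans pn.
  move=> y s; rewrite -partial_translate ?Hp//; by case: tpsi.
(* The constant term is the value at y = 0; the sign comes from translate y,
   which evaluates at x - y. *)
pose p : mpoly.mpoly d R := mpoly.mpolyC d (T psi) -
  \sum_i (@mpoly.mpolyX d R (mpoly.mnm1 i)) * q i.
exists p; split.
  apply: (leq_trans (mpoly.msizeD_le _ _)); rewrite geq_max; apply/andP; split.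
    by rewrite mpoly.msizeC; case: (_ != 0).
  rewrite mpoly.msizeN; apply: (leq_trans (mpoly.msize_sum _ _ _)).
  apply/bigmax_leqP_seq => i _ _; have [qn _] := Hq i.
  have [->|q0] := eqVneq (q i) 0; first by rewrite mulr0 mpoly.msize0.
  have X0 : @mpoly.mpolyX d R (mpoly.mnm1 i) != 0.
    by rewrite -mpoly.msize_poly_eq0 mpoly.msizeX.
  by rewrite mpoly.msizeM// mpoly.msizeX mpoly.mdeg1.
have pE y : peval p y = T psi - \sum_i y i 0 * peval (q i) y.
  rewrite /peval /p mpoly.mevalB mpoly.mevalC
    (raddf_sum (mpoly.meval (fun i => y i 0))); congr (_ - _).
  by apply: eq_bigr => i _; rewrite /= mpoly.mevalM mpoly.mevalXU.
move=> y.
(* Up to the constant T psi, the difference of the two sides at s y. *)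
pose u (s : R) := T (translate (s *: y) psi) + \sum_i y i 0 * (s * peval (q i) (s *: y)).
have du (s : R) : is_derive s 1 u 0.
  have H1 := rdist_derive_orbit y s rT tpsi.
  have H2 : is_derive s 1 (fun s : R => \sum_i y i 0 * (s * peval (q i) (s *: y)))
      (\sum_i y i 0 * T (translate (s *: y) (partial psi i))).
    elim: (index_enum 'I_d) => [|i r IHr].
      by rewrite big_nil; under eq_fun do rewrite big_nil; exact: is_derive_cst.
    rewrite big_cons; under eq_fun do rewrite big_cons.
    have := is_deriveZ (y i 0) ((Hq i).2 y s); rewrite /GRing.scale/= => H3.
    exact: is_deriveD.
  by have := is_deriveD H1 H2; rewrite addNr.
have : u 0 = u 1 by apply: derive0_constant.
rewrite /u !scale0r !scale1r (_ : translate 0 psi = psi); last first.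
  by apply/funext => x; rewrite /translate subr0.
rewrite big1 ?addr0 => [|i _]; last by rewrite mul0r mulr0.
rewrite pE => ->; rewrite (eq_bigr (fun i => y i 0 * peval (q i) y)) ?addrK// => i _.
by rewrite mul1r.
Qed.

End Orbits.

(** * Distributions annihilated by iterated differences *)

Section RealFrechet.
Variables (R : realType) (d : nat).
Implicit Types (w : seq 'I_d) (i : 'I_d) (T : ('cV[R]_d -> R) -> R).

Lemma continuous_peval (p : mpoly.mpoly d R) : continuous (peval p).
Proof.
rewrite (_ : peval p = fun x =>
  \sum_(m <- mpoly.msupp p) mpoly.mcoeff m p * \prod_i x i 0 ^+ m i); last first.
  by apply/funext => x; exact: pevalE.
apply: (@continuous_sum _ _ _ _
  (fun m (x : 'cV[R]_d) => mpoly.mcoeff m p * \prod_i x i 0 ^+ m i)) => m.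
apply: continuous_mul; first exact: continuous_const.
elim: (index_enum 'I_d) => [|i r IH].
  by under eq_fun do rewrite big_nil; exact: continuous_const.
under eq_fun do rewrite big_cons; apply: continuous_mul => //.
elim: (m i) => [|k IHk]; first by under eq_fun do rewrite expr0; exact: continuous_const.
by under eq_fun do rewrite exprS; apply: continuous_mul => //; exact: coord_continuous.
Qed.

Lemma cont_supp_mul_test (p : mpoly.mpoly d R) A (phi : 'cV[R]_d -> R) :
  smooth phi -> vanishes_beyond A phi -> cont_supp A (fun x => peval p x * phi x).
Proof.
move=> sphi vphi; split.
  by apply: continuous_mul; [exact: continuous_peval|exact: smooth_continuous].
by move=> x Ax; rewrite vphi// mulr0.
Qed.

Lemma continuous_bounded_ball (g : 'cV[R]_d -> R) (A : R) : continuous g ->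
  exists K : R, forall x, `|x| <= A -> `|g x| <= K.
Proof.
move=> cg.
have := continuous_compact (continuous_subspaceT cg) (@compact_ball_cV R d A).
move=> /compact_bounded[M [Mr HM]]; exists (M + 1) => x xA.
by apply: (HM (M + 1)); [rewrite ltrDl|exists x].
Qed.

Lemma real_distribution_polynomial (p : mpoly.mpoly d R) :
  real_distribution (fun phi => integral_Rn (fun x => peval p x * phi x)).
Proof.
split.
- move=> a phi psi [s1 [A vA]] [s2 [B vB]].
  have c1 := cont_supp_mul_test p s1 (vanishes_beyond_le (B := Num.max A B) _ vA).
  have c2 := cont_supp_mul_test p s2 (vanishes_beyond_le (B := Num.max A B) _ vB).
  rewrite -(integral_Rn_linear a (c1 _) (c2 _)) ?le_max ?lexx ?orbT//.
  by congr integral_Rn; apply/funext => x; ring.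
- move=> A; have [K HK] := continuous_bounded_ball `|A| (@continuous_peval p).
  exists ((`|A| + `|A|) ^+ d * K), 0%N => phi M sphi vphi HM.
  have vphi' : vanishes_beyond `|A| phi by apply: vanishes_beyond_le vphi; exact: ler_norm.
  rewrite -mulrA; apply: le_integral_Rn => //; first exact: cont_supp_mul_test.
  have Mx x : `|phi x| <= M by apply: (HM [::]).
  have M0 : 0 <= M by apply: le_trans (Mx 0).
  have K0 : 0 <= K by apply: le_trans (HK 0 _); rewrite ?normr0.
  move=> x; have [xA|xA] := leP `|x| `|A|.
    by rewrite normrM ler_pM// HK.
  by rewrite vphi'// mulr0 normr0 mulr_ge0.
Qed.

Section Convolution.
Variables (psi chi : 'cV[R]_d -> R).
Hypotheses (tpsi : real_test psi) (tchi : real_test chi).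

(** A convolution is a superposition of translates, and [T] commutes with the
    superposition. *)
Lemma rdist_convolution T : real_distribution T ->
  T (fun x => integral_Rn (fun y => psi y * chi (x - y))) =
  integral_Rn (fun y => psi y * T (translate y chi)).
Proof.
move=> rT; have [spsi [A vA]] := tpsi; have [schi [B vB]] := tchi.
have E : (fun y x => psi y * chi (x - y)) = fun y x => psi y * translate y chi x + 0.
  by apply/funext => y; apply/funext => x; rewrite addr0.
rewrite (@rdist_integral_Rn R d T d (A + B) A (fun y x => psi y * chi (x - y)))//.
- congr integral_Rn; apply/funext => y; apply: rdistZ => //.
  exact: real_test_translate.
- rewrite E; split.
    move=> y; apply: smooth_lin; first exact: smooth_translate.
    exact: smooth_cst.
  move=> w; under eq_fun => q do
    rewrite (partials_lin _ _ (smooth_translate _ schi) (smooth_cst 0))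
      partials0 addr0 partials_translate//.
  apply: continuous_mul.
    apply: (@continuous_then _ _ _ fst psi); first exact: continuous_proj1.
    exact: smooth_continuous.
  apply: (@continuous_then _ _ _ (fun q : 'cV[R]_d * 'cV[R]_d => q.2 - q.1) (partials w chi)).
    apply: continuous_add; first exact: continuous_proj2.
    by apply: continuous_opp; exact: continuous_proj1.
  by apply: smooth_continuous; exact: smooth_partials.
- move=> y x xAB; have [yA|yA] := leP `|y| A; last by rewrite vA// mul0r.
  rewrite vB ?mulr0// -(ltrD2l A) (lt_le_trans xAB)//.
  by rewrite -{1}[x](subrK y) addrC (le_trans (ler_normD _ _))// lerD2r.
- by move=> x y Ay; rewrite vA// mul0r.
Qed.

Lemma convolution_comm x :
  integral_Rn (fun y => psi y * chi (x - y)) = integral_Rn (fun y => chi y * psi (x - y)).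
Proof.
have [spsi [A vA]] := tpsi; have [schi _] := tchi.
have cg : cont_supp A (fun y => psi y * chi (x - y)).
  split; last by move=> y Ay; rewrite vA// mul0r.
  apply: continuous_mul; first exact: smooth_continuous.
  apply: (@continuous_then _ _ _ (fun y : 'cV[R]_d => x - y) chi); last exact: smooth_continuous.
  apply: continuous_add; first exact: continuous_const.
  by apply: continuous_opp; exact: continuous_ident.
rewrite -(integral_Rn_affine x _ cg (s := -1)) ?mulrNN ?mulr1//.
congr integral_Rn; apply/funext => y.
by rewrite scaleN1r opprD opprK addrA subrr add0r mulrC.
Qed.

End Convolution.

Lemma real_test_mul (phi psi : 'cV[R]_d -> R) : real_test phi -> real_test psi ->
  real_test (fun x => phi x * psi x).
Proof.
move=> [s1 [A vA]] [s2 _]; split; first exact: smooth_mul.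
by exists A => x Ax; rewrite vA// mul0r.
Qed.

Lemma real_testZ (a : R) (phi : 'cV[R]_d -> R) : real_test phi -> real_test (fun x => a * phi x).
Proof.
move=> tphi; have := real_test_lin a tphi (@real_test0 R d).
by congr real_test; apply/funext => x; rewrite addr0.
Qed.

(** The square of a test function is a test function that is nonnegative and not
    zero, so it can be normalized. *)
Lemma unit_mass_test (phi : 'cV[R]_d -> R) x : real_test phi -> phi x != 0 ->
  exists2 chi : 'cV[R]_d -> R, real_test chi & integral_Rn chi = 1.
Proof.
move=> tphi px; have t2 := real_test_mul tphi tphi.
have [s2 [A v2]] := t2.
pose sq (y : 'cV[R]_d) : R := phi y * phi y; pose I := integral_Rn sq.
have c2 : cont_supp A sq by split => //; exact: smooth_continuous.
have c0 : cont_supp A (fun _ : 'cV[R]_d => 0 : R) by split => //; exact: continuous_const.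
have I0 : 0 < I.
  apply: (@integral_Rn_gt0 R d A _ x) => //.
  - by move=> y; rewrite /sq -expr2 sqr_ge0.
  - by rewrite /sq -expr2 lt_neqAle sqr_ge0 eq_sym expf_neq0.
exists (fun y => I^-1 * sq y); first exact: real_testZ.
have := integral_Rn_linear I^-1 c2 c0.
rewrite integral_Rn0 addr0 mulVf ?gt_eqF// => <-.
by congr integral_Rn; apply/funext => y; rewrite addr0.
Qed.

Lemma real_distributionB T S : real_distribution T -> real_distribution S ->
  real_distribution (fun phi => T phi - S phi).
Proof.
move=> rT rS; split.
- move=> a phi psi t1 t2; rewrite !rdist_lin//; ring.
- move=> A; have [C [N HC]] := rdist_bound rT A; have [C' [N' HC']] := rdist_bound rS A.
  exists (C + C'), (maxn N N') => phi M sphi vphi HM.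
  rewrite (le_trans (ler_normB _ _))// mulrDl lerD//.
    by apply: HC => // w x wN; apply: HM; rewrite leq_max wN.
  by apply: HC' => // w x wN; apply: HM; rewrite leq_max wN orbT.
Qed.

(** Fréchet's theorem for distributions, by induction on [n]. Let [chi] have
    integral one. The function [p y = T (translate y chi)] is a polynomial, and
    [psi |-> \int p psi] is [psi |-> T (chi * psi)], an average of translates of
    [T]. On iterated differences of length [n] the values of [T] are invariant under
    translation, so there the average coincides with [T], and the difference of
    the two distributions is covered by the induction hypothesis. *)
Theorem real_distribution_frechet T n : real_distribution T -> annihilates_differences n T ->
  exists p : mpoly.mpoly d R, (mpoly.msize p <= n)%N /\
    forall phi, real_test phi -> T phi = integral_Rn (fun x => peval p x * phi x).
Proof.
have [all0|] := pselect (forall phi : 'cV[R]_d -> R, real_test phi -> forall x, phi x = 0).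
  move=> rT _; exists 0; rewrite mpoly.msize0; split => // phi tphi.
  rewrite (_ : phi = fun=> 0) ?rdist0//; last by apply/funext => x; exact: all0.
  by under eq_fun do rewrite mulr0; rewrite integral_Rn0.
move=> /existsNP[phi0 /not_implyP[tphi0 /existsNP[x0 /eqP px0]]].
have [chi tchi chi1] := unit_mass_test tphi0 px0.
elim: n T => [|n IH] T rT aT.
  exists 0; rewrite mpoly.msize0; split => // phi tphi.
  rewrite (aT [::] phi)//; under eq_fun do rewrite /peval mpoly.meval0 mul0r.
  by rewrite integral_Rn0.
have [p [pn Hp]] := orbit_polynomial rT aT tchi.
(* Both sides are T (chi * psi), computed with the two orders of convolution. *)
have smoothing psi : real_test psi -> integral_Rn (fun x => peval p x * psi x) =
    integral_Rn (fun y => chi y * T (translate y psi)).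
  move=> tpsi; rewrite -(rdist_convolution tchi tpsi rT).
  transitivity (T (fun x => integral_Rn (fun y => psi y * chi (x - y)))).
    rewrite (rdist_convolution tpsi tchi rT); congr integral_Rn; apply/funext => y.
    by rewrite Hp mulrC.
  by congr T; apply/funext => x; exact: convolution_comm.
pose S phi := T phi - integral_Rn (fun x => peval p x * phi x).
have rS : real_distribution S.
  by apply: real_distributionB => //; exact: real_distribution_polynomial.
have [q [qn Hq]] : exists q : mpoly.mpoly d R, (mpoly.msize q <= n)%N /\
    forall phi, real_test phi -> S phi = integral_Rn (fun x => peval q x * phi x).
  apply: IH => // l phi ln tphi; rewrite /S.
  have tD := real_test_differences l tphi.
  rewrite smoothing// (_ : (fun y => _) = fun y => T (differences l phi) * chi y + 0).
    have [schi [A vchi]] := tchi.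
    have cchi : cont_supp A chi by split => //; exact: smooth_continuous.
    have c0 : cont_supp A (fun _ : 'cV[R]_d => 0 : R) by split => //; exact: continuous_const.
    by rewrite (integral_Rn_linear _ cchi c0) integral_Rn0 chi1 mulr1 addr0 subrr.
  apply/funext => y; rewrite addr0 mulrC; congr (_ * _).
  apply/eqP; rewrite -subr_eq0 -rdist_sub//; last exact: real_test_translate.
  by apply/eqP; apply: (aT (y :: l)) => //=; rewrite ln.
exists (p + q); split.
  apply: (leq_trans (mpoly.msizeD_le _ _)); rewrite geq_max pn/=.
  exact: leq_trans qn _.
move=> phi tphi; have := Hq _ tphi; rewrite /S => /eqP; rewrite subr_eq => /eqP ->.
have [sphi [A vphi]] := tphi.
have := integral_Rn_linear 1 (cont_supp_mul_test q sphi vphi) (cont_supp_mul_test p sphi vphi).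
rewrite mul1r => <-; congr integral_Rn; apply/funext => x.
by rewrite /peval mpoly.mevalD; ring.
Qed.

End RealFrechet.

(** * Complex distributions *)

Section ComplexDistributions.
Variables (R : realType) (d : nat).
Local Notation C := R[i].
Implicit Types (phi psi : 'cV[R]_d -> C) (g : 'cV[R]_d -> R) (u : functional R d).

Lemma complex_eqP (x y : C) : complex.Re x = complex.Re y -> complex.Im x = complex.Im y -> x = y.
Proof. by case: x y => [a b] [a' b'] /= -> ->. Qed.

Lemma ReD (x y : C) : complex.Re (x + y) = complex.Re x + complex.Re y.
Proof. by case: x y => [a b] [a' b']. Qed.

Lemma ImD (x y : C) : complex.Im (x + y) = complex.Im x + complex.Im y.
Proof. by case: x y => [a b] [a' b']. Qed.

Lemma ReM (x y : C) :
  complex.Re (x * y) = complex.Re x * complex.Re y - complex.Im x * complex.Im y.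
Proof. by case: x y => [a b] [a' b']. Qed.

Lemma ImM (x y : C) :
  complex.Im (x * y) = complex.Re x * complex.Im y + complex.Im x * complex.Re y.
Proof. by case: x y => [a b] [a' b']. Qed.

(** Compactness of the support amounts to boundedness, as closed balls of columns
    are compact. *)
Lemma test_functionP phi : test_function phi <->
  real_test (fun x => complex.Re (phi x)) /\ real_test (fun x => complex.Im (phi x)).
Proof.
split=> [[s1 s2 cK]|[[s1 [A vA]] [s2 [B vB]]]].
  have [M [Mr HM]] := compact_bounded cK.
  have v0 x : M + 1 < `|x| -> phi x = 0.
    move=> Mx; apply/eqP; apply: contraLR Mx => px; rewrite -leNgt.
    by apply: (HM (M + 1)); [rewrite ltrDl|apply: subset_closure].
  by split; split=> //; exists (M + 1) => x /v0 ->.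
split=> //.
apply: (subclosed_compact _ (@compact_ball_cV R d (Num.max A B))).
  exact: closed_closure.
have clB : closed [set x : 'cV[R]_d | `|x| <= Num.max A B].
  by apply: compact_closed; [exact: norm_hausdorff|exact: compact_ball_cV].
move=> x; rewrite closureE; apply; split => // y /= py.
rewrite leNgt; apply: contra py; rewrite gt_max => /andP[Ay By].
by apply/eqP/complex_eqP; rewrite ?vA ?vB.
Qed.

Lemma real_test_complex g : real_test g -> test_function (fun x => (g x)%:C%C).
Proof. by move=> tg; apply/test_functionP; split=> //; exact: real_test0. Qed.

Definition re_part u g : R := complex.Re (u (fun x => (g x)%:C%C)).
Definition im_part u g : R := complex.Im (u (fun x => (g x)%:C%C)).

Section Parts.
Variable P : schwartz_distribution R d.

Lemma dist_real_lin (a : R) g h : real_test g -> real_test h ->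
  P (fun x => (a * g x + h x)%:C%C) =
  a%:C%C * P (fun x => (g x)%:C%C) + P (fun x => (h x)%:C%C).
Proof.
move=> tg th; rewrite -dist_linear; try exact: real_test_complex.
by congr (P _); apply/funext => x; apply: complex_eqP; rewrite ?ReD ?ImD ?ReM ?ImM /=; ring.
Qed.

Lemma dist_real_bound A : exists K N, forall g M, smooth g -> vanishes_beyond A g ->
  (forall w x, (size w <= N)%N -> `|partials w g x| <= M) ->
  `|P (fun x => (g x)%:C%C)| <= (K * M)%:C%C.
Proof.
have [K [N HK]] := dist_continuous P (@compact_ball_cV R d A).
exists K, N => g M sg vg HM; apply: HK.
- by apply: real_test_complex; split => //; exists A.
- by move=> x /= /negP; rewrite -ltNge => /vg ->.
- move=> w x wN; rewrite /cpartials /= partials0 normc_def /= expr0n addr0 sqrtr_sqr.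
  by rewrite lecR; exact: HM.
Qed.

Lemma real_distribution_re : real_distribution (re_part P).
Proof.
split.
- by move=> a g h tg th; rewrite /re_part dist_real_lin// ReD ReM mul0r subr0.
- move=> A; have [K [N HK]] := dist_real_bound A; exists K, N => g M sg vg HM.
  by rewrite -lecR; apply: le_trans (HK _ _ sg vg HM); exact: normc_ge_Re.
Qed.

Lemma normc_ge_Im (x : C) : (`|complex.Im x|%:C)%C <= `|x|.
Proof.
by case: x => a b; rewrite normc_def lecR /= -[leLHS]sqrtr_sqr ler_wsqrtr// lerDr sqr_ge0.
Qed.

Lemma real_distribution_im : real_distribution (im_part P).
Proof.
split.
- by move=> a g h tg th; rewrite /im_part dist_real_lin// ImD ImM mul0r addr0.
- move=> A; have [K [N HK]] := dist_real_bound A; exists K, N => g M sg vg HM.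
  by rewrite -lecR; apply: le_trans (HK _ _ sg vg HM); exact: normc_ge_Im.
Qed.

Lemma dist_split phi : test_function phi ->
  P phi = 'i%C * P (fun x => (complex.Im (phi x))%:C%C) + P (fun x => (complex.Re (phi x))%:C%C).
Proof.
move=> /test_functionP[t1 t2]; rewrite -dist_linear; try exact: real_test_complex.
by congr (P _); apply/funext => x; apply: complex_eqP; rewrite ?ReD ?ImD ?ReM ?ImM /=; ring.
Qed.

End Parts.

(** The difference operators act on the functional by translating its argument;
    applied to a distribution this is composition with [differences], by
    [iterated_difference_real]. *)
Fixpoint iterated_difference (l : seq 'cV[R]_d) u : functional R d :=
  fun phi => if l is h :: l' then
    iterated_difference l' u (translate h phi) - iterated_difference l' u phi
  else u phi.

Lemma differences_translate l h g : differences l (translate h g) = translate h (differences l g).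
Proof.
elim: l => [//|k l IH]; apply/funext => x; rewrite /= IH /translate.
by congr (differences l g _ - _); rewrite addrAC.
Qed.

Lemma iterated_difference_real (P : schwartz_distribution R d) l g : real_test g ->
  iterated_difference l P (fun x => (g x)%:C%C) = P (fun x => (differences l g x)%:C%C).
Proof.
elim: l g => [//|h l IH] g tg.
rewrite /= (IH g)// (IH (translate h g)); last exact: real_test_translate.
have tD := real_test_differences l tg.
have := dist_real_lin P (-1) tD (real_test_translate h tD).
rewrite differences_translate => E.
transitivity ((-1)%:C%C * P (fun x => (differences l g x)%:C%C) +
  P (fun x => (translate h (differences l g) x)%:C%C)).
  by rewrite (_ : (-1)%:C%C = -1 :> C) ?mulN1r 1?addrC//; apply: complex_eqP; rewrite /= ?oppr0.
rewrite -E; congr (P _); apply/funext => x; congr (_%:C)%C.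
by rewrite mulN1r addrC.
Qed.

Definition complexify (p : mpoly.mpoly d R) : mpoly.mpoly d C :=
  \sum_(m <- mpoly.msupp p) GRing.scale (mpoly.mcoeff m p)%:C%C (@mpoly.mpolyX d C m).

Lemma meval_complexify p (x : 'cV[R]_d) :
  mpoly.meval (fun i => (x i 0)%:C%C) (complexify p) = (peval p x)%:C%C.
Proof.
rewrite pevalE (raddf_sum (mpoly.meval _)) (raddf_sum (real_complex R)).
apply: eq_bigr => m _; rewrite /= mpoly.mevalZ mpoly.mevalX rmorphM rmorph_prod.
by congr (_ * _); apply: eq_bigr => i _; rewrite rmorphXn.
Qed.

Lemma msize_complexify p : (mpoly.msize (complexify p) <= mpoly.msize p)%N.
Proof.
apply: (leq_trans (mpoly.msize_sum _ _ _)); rewrite big_seq; apply/bigmax_leqP_seq => m _ mp.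
apply: (leq_trans (mpoly.msizeZ_le _ _)); rewrite mpoly.msizeX.
exact: mpoly.msize_mdeg_lt.
Qed.

Lemma polynomial_of_iterated_differences (P : schwartz_distribution R d) n :
  (forall l phi, size l = n.+1 -> test_function phi -> iterated_difference l P phi = 0) ->
  is_polynomial_of_degree_le n P.
Proof.
move=> aP.
have aD l g : size l = n.+1 -> real_test g -> P (fun x => (differences l g x)%:C%C) = 0.
  by move=> ln tg; rewrite -iterated_difference_real// aP//; exact: real_test_complex.
have [p1 [n1 H1]] := real_distribution_frechet (real_distribution_re P)
  (fun l g ln tg => congr1 (@complex.Re R) (aD l g ln tg)).
have [p2 [n2 H2]] := real_distribution_frechet (real_distribution_im P)
  (fun l g ln tg => congr1 (@complex.Im R) (aD l g ln tg)).
exists (complexify p1 + GRing.scale 'i%C (complexify p2)); split.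
  apply: (leq_trans (mpoly.msizeD_le _ _)); rewrite geq_max (leq_trans (msize_complexify _))//=.
  by rewrite (leq_trans (mpoly.msizeZ_le _ _))// (leq_trans (msize_complexify _)).
move=> phi tphi; rewrite (dist_split _ tphi).
have [t1 t2] := (test_functionP _).1 tphi.
have [s1 [A vA]] := t1; have [s2 [B vB]] := t2.
pose D := Num.max A B.
have vA' : vanishes_beyond D (fun x => complex.Re (phi x)).
  by apply: vanishes_beyond_le vA; rewrite le_max lexx.
have vB' : vanishes_beyond D (fun x => complex.Im (phi x)).
  by apply: vanishes_beyond_le vB; rewrite le_max lexx orbT.
have E (x : 'cV[R]_d) :
    mpoly.meval (fun i => (x i 0)%:C%C)
      (complexify p1 + GRing.scale 'i%C (complexify p2)) * phi x =
    ((-1 * (peval p2 x * complex.Im (phi x)) + peval p1 x * complex.Re (phi x)) +i*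
     (1 * (peval p1 x * complex.Im (phi x)) + peval p2 x * complex.Re (phi x)))%C.
  rewrite mpoly.mevalD mpoly.mevalZ !meval_complexify.
  by apply: complex_eqP; rewrite ?(ReD, ImD, ReM, ImM) /=; ring.
rewrite /regular_dist /cintegral_Rn.
rewrite (_ : (fun x => complex.Re _) = fun x => -1 * (peval p2 x * complex.Im (phi x)) +
  peval p1 x * complex.Re (phi x)); last by apply/funext => x; rewrite E.
rewrite (_ : (fun x => complex.Im (_ * _)) = fun x => 1 * (peval p1 x * complex.Im (phi x)) +
  peval p2 x * complex.Re (phi x)); last by apply/funext => x; rewrite E.
rewrite (integral_Rn_linear (-1) (cont_supp_mul_test p2 s2 vB') (cont_supp_mul_test p1 s1 vA')).
rewrite (integral_Rn_linear 1 (cont_supp_mul_test p1 s2 vB') (cont_supp_mul_test p2 s1 vA')).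
rewrite -!H1// -!H2//.
by apply: complex_eqP; rewrite ?(ReD, ImD, ReM, ImM) /re_part /im_part /=; ring.
Qed.

End ComplexDistributions.

(** * Tensor products and convolutions *)

Section TensorProducts.
Variables (R : realType) (d : nat).
Local Notation C := R[i].

Lemma usubmx_basis (i : 'I_(d + d)) : usubmx (delta_mx i 0 : 'cV[R]_(d + d)) =
  if fintype.split i is inl j then delta_mx j 0 else 0.
Proof.
rewrite -[in LHS](splitK i); case: (fintype.split i) => j; apply/matrixP => k l.
  by rewrite !mxE /= (inj_eq (@lshift_inj _ _)).
by rewrite !mxE /= eq_lrshift.
Qed.

Lemma dsubmx_basis (i : 'I_(d + d)) : dsubmx (delta_mx i 0 : 'cV[R]_(d + d)) =
  if fintype.split i is inr j then delta_mx j 0 else 0.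
Proof.
rewrite -[in LHS](splitK i); case: (fintype.split i) => j; apply/matrixP => k l.
  by rewrite !mxE /= eq_rlshift.
by rewrite !mxE /= (inj_eq (@rshift_inj _ _)).
Qed.

(** A projection onto a block of coordinates sends each basis vector to a basis
    vector or to zero, so a partial derivative of the composite is again a smooth
    function composed with the projection. *)
Lemma smooth_comp_coordinates (pr : 'cV[R]_(d + d) -> 'cV[R]_d) (g : 'cV[R]_d -> R) :
  continuous pr -> (forall z (s : R) v, pr (z + s *: v) = pr z + s *: pr v) ->
  (forall i, pr (delta_mx i 0) = 0 \/ exists j, pr (delta_mx i 0) = delta_mx j 0) ->
  smooth g -> smooth (fun z => g (pr z)).
Proof.
move=> cpr lpr bpr sg.
apply: (@smoothP R (d + d) (fun h => exists2 g, smooth g & h = fun z => g (pr z)));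
  last by exists g.
move=> _ [{}g {}sg ->].
have D i : exists2 g', smooth g' &
    forall z, is_derive z (delta_mx i 0) (fun z => g (pr z)) (g' (pr z)).
  have [E|[j E]] := bpr i.
    exists (fun=> 0) => [|z]; first exact: smooth_cst.
    apply/is_derive_line0; under eq_fun do rewrite lpr E scaler0 addr0.
    exact: is_derive_cst.
  exists (partial g j) => [|z]; first exact: smooth_partial.
  apply/is_derive_line0; under eq_fun do rewrite lpr E.
  by apply: (is_derive_line0 g (pr z) (delta_mx j 0) _).1; exact/derivableP/smooth_derivable.
split.
- by apply: (@continuous_then _ _ _ pr g) => //; exact: smooth_continuous.
- by move=> i x; have [g' _ H] := D i; have Hx := H x; exact: (@ex_derive _ _ _ _ _ _ _ Hx).
- move=> i; have [g' sg' H] := D i; exists g' => //; apply/funext => z.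
  by have Hz := H z; apply: derive_val.
Qed.

Lemma real_test_tensor (g h : 'cV[R]_d -> R) : real_test g -> real_test h ->
  real_test (fun z : 'cV[R]_(d + d) => g (usubmx z) * h (dsubmx z)).
Proof.
move=> [sg [A vA]] [sh [B vB]]; split.
  apply: smooth_mul.
    apply: smooth_comp_coordinates => //; first exact: continuous_usubmx.
      by move=> z s v; rewrite !linearD !linearZ.
    move=> i; rewrite usubmx_basis; case: (fintype.split i) => j; last by left.
    by right; exists j.
  apply: smooth_comp_coordinates => //; first exact: continuous_dsubmx.
    by move=> z s v; rewrite !linearD !linearZ.
  move=> i; rewrite dsubmx_basis; case: (fintype.split i) => j; first by left.
  by right; exists j.
exists (Num.max `|A| `|B|) => z zAB.
have [uA|uA] := leP `|usubmx z| `|A|; last by rewrite vA ?mul0r// (le_lt_trans (ler_norm _) uA).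
have [uB|uB] := leP `|dsubmx z| `|B|; last by rewrite vB ?mulr0// (le_lt_trans (ler_norm _) uB).
suff : `|z| <= Num.max `|A| `|B| by rewrite leNgt zAB.
have M0 : 0 <= Num.max `|A| `|B| by rewrite le_max normr_ge0.
apply/mx_norm_leP => // i j; rewrite -(vsubmxK z) -(splitK i).
case: (fintype.split i) => k /=.
  rewrite col_mxEu le_max; apply/orP; left.
  by move: uA => /mx_norm_leP; apply.
rewrite col_mxEd le_max; apply/orP; right.
by move: uB => /mx_norm_leP; apply.
Qed.

Lemma test_function_tensor (phi psi : 'cV[R]_d -> C) : test_function phi -> test_function psi ->
  test_function (tensor_fun phi psi).
Proof.
move=> /test_functionP[t1 t2] /test_functionP[t3 t4]; apply/test_functionP; split.
  under eq_fun do rewrite /tensor_fun ReM.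
  exact: (real_test_sub (real_test_tensor t1 t3) (real_test_tensor t2 t4)).
under eq_fun do rewrite /tensor_fun ImM.
have := real_test_lin 1 (real_test_tensor t1 t4) (real_test_tensor t2 t3).
by congr real_test; apply/funext => z; rewrite mul1r.
Qed.

Lemma test_function_translate h (phi : 'cV[R]_d -> C) : test_function phi ->
  test_function (translate h phi).
Proof.
move=> /test_functionP[t1 t2]; apply/test_functionP.
by split; [exact: (real_test_translate h t1)|exact: (real_test_translate h t2)].
Qed.

Lemma cintegral_translate A h (phi : 'cV[R]_d -> C) :
  cont_supp A (fun x => complex.Re (phi x)) -> cont_supp A (fun x => complex.Im (phi x)) ->
  cintegral_Rn (translate h phi) = cintegral_Rn phi.
Proof.
move=> c1 c2; rewrite /cintegral_Rn.
rewrite -(integral_Rn_affine (- h) (mulr1 1) c1) -(integral_Rn_affine (- h) (mulr1 1) c2).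
by congr (_ +i* _)%C; congr integral_Rn; apply/funext => x; rewrite scale1r addrC.
Qed.

(** If [invmx c *m y] lies in a ball, then [y] lies in the image of this ball by
    [c], which is bounded. *)
Lemma vanishes_invertible A (g : 'cV[R]_d -> R) (c : 'M[R]_d) : c \in unitmx ->
  vanishes_beyond A g -> exists B, vanishes_beyond B (fun y => g (invmx c *m y)).
Proof.
move=> uc vg.
have := continuous_compact (continuous_subspaceT (@continuous_mulmx R d d c))
  (@compact_ball_cV R d A).
move=> /compact_bounded[M [Mr HM]]; exists (M + 1) => y yM.
apply: vg; rewrite ltNge; apply: contraL yM => yA; rewrite -leNgt.
apply: (HM (M + 1)); first by rewrite ltrDl.
by exists (invmx c *m y) => //; rewrite mulKVmx.
Qed.

(** The translations by [h] and [k] move the convolution by [b *m h + c *m k]. When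
    this sum is zero they only translate the variable of integration, by
    [c *m k]. *)
Lemma convolution_sigma_translate (b c : 'M[R]_d) h k (phi psi : 'cV[R]_d -> C) :
  b \in unitmx -> c \in unitmx -> b *m h + c *m k = 0 ->
  test_function phi -> test_function psi ->
  convolution (sigma_inv b (translate h phi)) (sigma_inv c (translate k psi)) =
  convolution (sigma_inv b phi) (sigma_inv c psi).
Proof.
move=> ub uc bc /test_functionP[[s1 _] [s2 _]] /test_functionP[[s3 [A3 v3]] [s4 [A4 v4]]].
apply/funext => z; rewrite /convolution.
pose G y := sigma_inv b phi (z - y) * sigma_inv c psi y.
rewrite (_ : (fun y => _ * _) = translate (c *m k) G); last first.
  apply/funext => y; rewrite /G /translate /sigma_inv; congr (phi _ * psi _).
    rewrite -[in LHS](mulKmx ub h) -mulmxBr; congr (_ *m _).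
    have -> : b *m h = - (c *m k) by apply/eqP; rewrite -addr_eq0 bc.
    by rewrite !opprK opprB addrA addrAC.
  by rewrite mulmxBr mulKmx.
have cs (g : 'cV[R]_d -> R) (M : 'M[R]_d) f : continuous f -> smooth g ->
    continuous (fun y : 'cV[R]_d => g (M *m f y)).
  move=> cf sg; apply: (@continuous_then _ _ _ (fun y => M *m f y) g);
    last exact: smooth_continuous.
  by apply: (@continuous_then _ _ _ f (fun y => M *m y)) => //; exact: continuous_mulmx.
have cz : continuous (fun y : 'cV[R]_d => z - y).
  apply: continuous_add; first exact: continuous_const.
  by apply: continuous_opp; exact: continuous_ident.
have ci := @continuous_ident 'cV[R]_d.
have [B3 w3] := vanishes_invertible uc v3; have [B4 w4] := vanishes_invertible uc v4.
pose B := Num.max B3 B4.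
have psi0 y : B < `|y| -> psi (invmx c *m y) = 0.
  by rewrite gt_max => /andP[y3 y4]; apply: complex_eqP; [exact: w3|exact: w4].
apply: (@cintegral_translate B).
  split; last by move=> y By; rewrite /G /sigma_inv psi0// mulr0.
  under eq_fun do rewrite /G ReM.
  apply: continuous_add; last apply: continuous_opp; apply: continuous_mul; rewrite /sigma_inv.
  - exact: (cs (fun x => complex.Re (phi x))).
  - exact: (cs (fun x => complex.Re (psi x))).
  - exact: (cs (fun x => complex.Im (phi x))).
  - exact: (cs (fun x => complex.Im (psi x))).
split; last by move=> y By; rewrite /G /sigma_inv psi0// mulr0.
under eq_fun do rewrite /G ImM.
apply: continuous_add; apply: continuous_mul; rewrite /sigma_inv.
- exact: (cs (fun x => complex.Re (phi x))).
- exact: (cs (fun x => complex.Im (psi x))).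
- exact: (cs (fun x => complex.Im (phi x))).
- exact: (cs (fun x => complex.Re (psi x))).
Qed.

(** The function [b x + c y] does not change when [(h, k)] is added to [(x, y)]. *)
Lemma lin_subst_invariant (f : schwartz_distribution R d) (b c : 'M[R]_d)
    (F : schwartz_distribution R (d + d)) h k (phi psi : 'cV[R]_d -> C) :
  b \in unitmx -> c \in unitmx -> is_lin_subst f b c F -> b *m h + c *m k = 0 ->
  test_function phi -> test_function psi ->
  F (tensor_fun (translate h phi) (translate k psi)) = F (tensor_fun phi psi).
Proof.
move=> ub uc hF bc t1 t2; rewrite !hF//; try exact: test_function_translate.
by rewrite convolution_sigma_translate.
Qed.

Definition total_mass (phi : 'cV[R]_d -> C) : C := regular_dist (fun=> 1) phi.

Lemma total_massE phi : total_mass phi = cintegral_Rn phi.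
Proof.
rewrite /total_mass /regular_dist; congr cintegral_Rn.
by apply/funext => x; rewrite mul1r.
Qed.

Lemma total_mass_translate h phi : test_function phi ->
  total_mass (translate h phi) = total_mass phi.
Proof.
move=> /test_functionP[[s1 [A vA]] [s2 [B vB]]]; rewrite !total_massE.
apply: (@cintegral_translate (Num.max A B)); split; try exact: smooth_continuous.
  by apply: vanishes_beyond_le vA; rewrite le_max lexx.
by apply: vanishes_beyond_le vB; rewrite le_max lexx orbT.
Qed.

End TensorProducts.

(** * Differences in two groups of variables *)

Section PairedDifferences.
Variables (R : realType) (d : nat).
Local Notation C := R[i].
Local Notation field := ('cV[R]_d -> C).
Implicit Types (E : field -> field -> C) (l : seq ('cV[R]_d * 'cV[R]_d)).

Fixpoint paired_difference l E : field -> field -> C := fun phi psi =>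
  if l is hk :: l' then
    paired_difference l' E (translate hk.1 phi) (translate hk.2 psi) -
    paired_difference l' E phi psi
  else E phi psi.

Definition invariant_under E (hk : 'cV[R]_d * 'cV[R]_d) := forall phi psi,
  test_function phi -> test_function psi ->
  E (translate hk.1 phi) (translate hk.2 psi) = E phi psi.

Lemma translateC (h k : 'cV[R]_d) (phi : field) :
  translate h (translate k phi) = translate k (translate h phi).
Proof. by apply/funext => x; rewrite /translate addrAC. Qed.

Lemma paired_difference_invariant l E hk : invariant_under E hk ->
  invariant_under (paired_difference l E) hk.
Proof.
move=> iE; elim: l => [//|hk' l IH] phi psi t1 t2 /=.
rewrite (translateC hk'.1) (translateC hk'.2) !IH//; exact: test_function_translate.
Qed.

(** Translations commute, so the order of the differences is immaterial: the one
    along [hk] may act first, where it gives zero. *)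
Lemma paired_difference_killed l E hk phi psi : hk \in l -> invariant_under E hk ->
  test_function phi -> test_function psi -> paired_difference l E phi psi = 0.
Proof.
move=> + iE; elim: l phi psi => [//|hk' l IH] phi psi; rewrite inE => /orP[/eqP <-|hl] t1 t2 /=.
  by rewrite paired_difference_invariant// subrr.
by rewrite !IH ?subrr//; exact: test_function_translate.
Qed.

Lemma eq_paired_difference l E E' phi psi :
  (forall phi psi, test_function phi -> test_function psi -> E phi psi = E' phi psi) ->
  test_function phi -> test_function psi ->
  paired_difference l E phi psi = paired_difference l E' phi psi.
Proof.
move=> EE'; elim: l phi psi => [|hk l IH] phi psi t1 t2 /=; first exact: EE'.
by rewrite !IH//; exact: test_function_translate.
Qed.

Lemma paired_difference_sum l (I : Type) (r : seq I) (E : I -> field -> field -> C) phi psi :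
  paired_difference l (fun phi psi => \sum_(i <- r) E i phi psi) phi psi =
  \sum_(i <- r) paired_difference l (E i) phi psi.
Proof. by elim: l phi psi => [//|hk l IH] phi psi /=; rewrite !IH sumrB. Qed.

Lemma paired_difference_separated l (P Q : functional R d) phi psi :
  test_function phi -> test_function psi ->
  paired_difference l (fun phi psi => P phi * total_mass psi + total_mass phi * Q psi) phi psi =
  iterated_difference (map fst l) P phi * total_mass psi +
  total_mass phi * iterated_difference (map snd l) Q psi.
Proof.
elim: l phi psi => [//|hk l IH] phi psi t1 t2 /=.
rewrite !IH//; try exact: test_function_translate.
by rewrite !total_mass_translate//; ring.
Qed.

(** This dichotomy replaces the construction of a bump function: if there were no
    nonzero test function, all distributions would be zero. *)
Lemma unit_mass_or_trivial :
  (exists2 chi : field, test_function chi & total_mass chi = 1) \/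
  (forall phi : field, test_function phi -> phi = fun=> 0).
Proof.
have [[phi [x [tphi px]]]|H] := pselect (
  exists (phi : 'cV[R]_d -> R) x, real_test phi /\ phi x != 0).
  left; have [chi tchi chi1] := unit_mass_test tphi px.
  exists (fun x => (chi x)%:C%C); first exact: real_test_complex.
  by rewrite total_massE /cintegral_Rn /= chi1 integral_Rn0.
right=> phi /test_functionP[t1 t2]; apply/funext => x.
apply: complex_eqP; apply/eqP/negPn/negP => px; apply: H.
  by exists (fun x => complex.Re (phi x)), x.
by exists (fun x => complex.Im (phi x)), x.
Qed.

Lemma iterated_difference_zero (l : seq 'cV[R]_d) (u : functional R d) (phi : field) :
  (forall phi, test_function phi -> u phi = 0) -> test_function phi ->
  iterated_difference l u phi = 0.
Proof.
move=> u0; elim: l phi => [|h l IH] phi tphi /=; first exact: u0.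
by rewrite !IH ?subrr//; exact: test_function_translate.
Qed.

Lemma dist0 (P : schwartz_distribution R d) : P (fun=> 0) = 0.
Proof.
have t0 : test_function (fun _ : 'cV[R]_d => 0 : C).
  exact: (real_test_complex (@real_test0 R d)).
have := dist_linear P (-1) t0 t0.
rewrite [in X in _ = X]mulN1r [X in _ = X]addNr => H; rewrite -[RHS]H.
by congr (P _); apply/funext => x; rewrite mulr0 addr0.
Qed.

Lemma vanishes_by_total_mass (P : schwartz_distribution R d) (l : seq 'cV[R]_d) (hl :
    forall phi psi : field, test_function phi -> test_function psi ->
    iterated_difference l P phi * total_mass psi = 0) phi :
  test_function phi -> iterated_difference l P phi = 0.
Proof.
move=> tphi; have [[chi tchi chi1]|all0] := unit_mass_or_trivial.
  by rewrite -[LHS]mulr1 -chi1 hl.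
by apply: iterated_difference_zero => // psi /all0 ->; exact: dist0.
Qed.

End PairedDifferences.

(** * The functional equation *)

Section FunctionalEquation.
Variables (R : realType) (d m : nat).
Local Notation C := R[i].
Local Notation field := ('cV[R]_d -> C).

(** The assumption says that the [m]-fold differences of [P] are constants, since
    the second summand sees [phi] only through its total mass. They are zero when
    [Q] is; otherwise a further difference removes the constant. *)
Lemma polynomial_of_separated_cancellation (P Q : schwartz_distribution R d) (hm : (0 < m)%N)
  (H : forall hs : seq 'cV[R]_d, size hs = m -> exists ks : seq 'cV[R]_d,
     forall phi psi : field, test_function phi -> test_function psi ->
     iterated_difference hs P phi * total_mass psi +
     total_mass phi * iterated_difference ks Q psi = 0) :
  is_polynomial_of_degree_le m P /\
  (dist_eq Q (fun=> 0) -> is_polynomial_of_degree_le m.-1 P).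
Proof.
split=> [|Q0]; apply: polynomial_of_iterated_differences.
  move=> [//|g hs] phi [hsm] tphi; apply: vanishes_by_total_mass => // {tphi}phi psi t1 t2 /=.
  have [ks Hk] := H hs hsm; have tg := test_function_translate g t1.
  have := Hk _ _ tg t2; rewrite total_mass_translate// => H1.
  have H2 := Hk _ _ t1 t2.
  by rewrite mulrBl -[RHS](subrr (0 : C)) -{1}H1 -H2; ring.
rewrite prednK// => l phi lm; apply: vanishes_by_total_mass => {}phi psi t1 t2.
have [ks Hk] := H l lm; have := Hk _ _ t1 t2.
by rewrite (iterated_difference_zero ks Q0)// mulr0 addr0.
Qed.

Section Cancellation.
Variables (P Q : schwartz_distribution R d) (f : 'I_m -> schwartz_distribution R d).
Variables (b c : 'I_m -> 'M[R]_d).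
Hypotheses (hb : forall i, b i \in unitmx) (hc : forall i, c i \in unitmx).
Variable F : 'I_m -> schwartz_distribution R (d + d).
Hypothesis hF : forall i, is_lin_subst (f i) (b i) (c i) (F i).
Variables P1 Q1 : schwartz_distribution R (d + d).
Hypothesis hP1 : is_tensor P (regular_dist (fun=> 1)) P1.
Hypothesis hQ1 : is_tensor (regular_dist (fun=> 1)) Q Q1.
Hypothesis heq : dist_eq (fun Phi => \sum_(i < m) F i Phi) (fun Phi => P1 Phi + Q1 Phi).

(** Each summand of the functional equation is invariant under one of the pairs
    of translations in [l], so the corresponding difference kills it. *)
Lemma separated_cancellation (l : seq ('cV[R]_d * 'cV[R]_d)) (phi psi : field) :
  (forall i, exists2 hk, hk \in l & b i *m hk.1 + c i *m hk.2 = 0) ->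
  test_function phi -> test_function psi ->
  iterated_difference (map fst l) P phi * total_mass psi +
  total_mass phi * iterated_difference (map snd l) Q psi = 0.
Proof.
move=> Hl t1 t2; rewrite -paired_difference_separated//.
transitivity (paired_difference l
    (fun phi psi => \sum_(i <- index_enum 'I_m) F i (tensor_fun phi psi)) phi psi).
  apply: eq_paired_difference => // {t1 t2 phi psi}phi psi t1 t2.
  by rewrite heq ?hP1 ?hQ1//; exact: test_function_tensor.
rewrite (paired_difference_sum l _ (fun i phi psi => F i (tensor_fun phi psi))) big1// => i _.
have [hk hkl E] := Hl i; apply: (paired_difference_killed hkl) => // u v tu tv.
exact: (lin_subst_invariant (hb i) (hc i) (hF i) E).
Qed.

Lemma map_nth_enum_ord (hs : seq 'cV[R]_d) : size hs = m ->
  [seq nth 0 hs i | i : 'I_m <- enum 'I_m] = hs.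
Proof.
move=> hsm; rewrite (map_comp (nth 0 hs) val) val_enum_ord -hsm.
exact: mkseq_nth.
Qed.

(** The vectors [hs] are prescribed; invertibility of [c i] provides the companion
    of the [i]-th one that leaves [b i x + c i y] unchanged. *)
Lemma cancellation_left hs : size hs = m -> exists ks : seq 'cV[R]_d,
  forall phi psi : field, test_function phi -> test_function psi ->
  iterated_difference hs P phi * total_mass psi +
  total_mass phi * iterated_difference ks Q psi = 0.
Proof.
move=> hsm; pose k i := - (invmx (c i) *m (b i *m nth 0 hs i)).
pose l := [seq (nth 0 hs i, k i) | i : 'I_m <- enum 'I_m].
exists (map snd l) => phi psi t1 t2.
have E : map fst l = hs by rewrite /l -map_comp; exact: map_nth_enum_ord.
rewrite -E; apply: separated_cancellation => // i.
exists (nth 0 hs i, k i) => /=; first by apply: map_f; rewrite mem_enum.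
by rewrite /k mulmxN mulKVmx// subrr.
Qed.

(** The same with the roles of the two groups of variables exchanged, by
    invertibility of [b i]. *)
Lemma cancellation_right ks : size ks = m -> exists hs : seq 'cV[R]_d,
  forall psi phi : field, test_function psi -> test_function phi ->
  iterated_difference ks Q psi * total_mass phi +
  total_mass psi * iterated_difference hs P phi = 0.
Proof.
move=> ksm; pose h i := - (invmx (b i) *m (c i *m nth 0 ks i)).
pose l := [seq (h i, nth 0 ks i) | i : 'I_m <- enum 'I_m].
exists (map fst l) => psi phi t1 t2.
have E : map snd l = ks by rewrite /l -map_comp; exact: map_nth_enum_ord.
rewrite -E addrC mulrC [X in _ + X]mulrC; apply: separated_cancellation => // i.
exists (h i, nth 0 ks i) => /=; first by apply: map_f; rewrite mem_enum.
by rewrite /h mulmxN mulKVmx// addNr.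
Qed.

End Cancellation.
End FunctionalEquation.

Theorem theorem8 (R : realType) (d m : nat) (hd : (0 < d)%N) (hm : (0 < m)%N)
  (P Q : schwartz_distribution R d) (f : 'I_m -> schwartz_distribution R d)
  (b c : 'I_m -> 'M[R]_d)
  (hb : forall i, b i \in unitmx) (hc : forall i, c i \in unitmx)
  (hbc : forall i j, i != j ->
    invmx (b i) *m c i - invmx (b j) *m c j \in unitmx)
  (F : 'I_m -> schwartz_distribution R (d + d))
  (hF : forall i, is_lin_subst (f i) (b i) (c i) (F i))
  (P1 : schwartz_distribution R (d + d))
  (hP1 : is_tensor P (regular_dist (fun=> 1)) P1)
  (Q1 : schwartz_distribution R (d + d))
  (hQ1 : is_tensor (regular_dist (fun=> 1)) Q Q1)
  (heq : dist_eq (fun Phi => \sum_(i < m) F i Phi)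
                 (fun Phi => P1 Phi + Q1 Phi)) :
  [/\ is_polynomial_of_degree_le m P /\ is_polynomial_of_degree_le m Q,
      dist_eq Q (fun=> 0) -> is_polynomial_of_degree_le m.-1 P &
      dist_eq P (fun=> 0) -> is_polynomial_of_degree_le m.-1 Q].
Proof.
have [PP PQ0] := polynomial_of_separated_cancellation hm
  (cancellation_left hb hc hF hP1 hQ1 heq).
have [QP QP0] := polynomial_of_separated_cancellation hm
  (cancellation_right hb hc hF hP1 hQ1 heq).
by [].
Qed.
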